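(* Fix $m,n\in\mathbb N$. Let $P(\mathbf q)=\mathbb Z^m$ for every $\mathbf q\in\mathbb Z^n$, and let $\psi:\mathbb Z_+^n\to\mathbb R_+$. Then \[\mathrm{Leb}(W_{n,m}^P(\psi))=\begin{cases}0&\text{if }\sum_{\mathbf q\in\mathbb Z_+^n}\psi(\mathbf q)^m<\infty,\\ 1&\text{if }\sum_{\mathbf q\in\mathbb Z_+^n}\psi(\mathbf q)^m=\infty\text{ and }\Psi\text{ is nonincreasing,}\end{cases}\] where $\Psi(d)=\big(\sum_{\mathbf q\in\mathbb Z_+^n,\ \gcd(\mathbf q)=d}\psi(\mathbf q)^m\big)^{1/m}\in[0,\infty]$ for $d\in\mathbb N$.
   Context: $\mathbb Z_+$ denotes nonnegative integers, $\mathbb R_+$ nonnegative reals; $|\cdot|$ is the maximum norm; $\gcd(\mathbf q)$ is the gcd of the entries of $\mathbf q$. $W_{n,m}^P(\psi)$ is the set of $\mathbf X\in\mathbb T^{nm}=M_{n\times m}(\mathbb R)/M_{n\times m}(\mathbb Z)$ such that $|\mathbf q\mathbf X-\mathbf p|<\psi(\mathbf q)$ (i.e. $\mathbf q\mathbf X\in B(\mathbf 0,\psi(\mathbf q))+\mathbb Z^m$) for infinitely many $\mathbf q\in\mathbb Z_+^n$, $\mathbf q$ a row vector and $\mathbf p\in\mathbb Z^m$. *)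

(* Defs.v *)
From HB Require Import structures.
From mathcomp Require Import all_boot all_order all_algebra generic_quotient.
From mathcomp Require Import all_classical all_reals all_analysis measurable_realfun.

Set Implicit Arguments.
Unset Strict Implicit.
Unset Printing Implicit Defensive.
Import Order.TTheory GRing.Theory Num.Theory.
Import numFieldNormedType.Exports.

Local Open Scope classical_set_scope.
Local Open Scope ring_scope.

Section LebesgueTuple.
Context (R : realType).
Local Notation T := (measurableTypeR R).

Definition cons_pair k (p : T * k.-tuple T) : k.+1.-tuple T :=
  [the k.+1.-tuple T of p.1 :: p.2].

Lemma measurable_cons_pair k : measurable_fun [set: _] (@cons_pair k).
Proof. exact: measurable_cons. Qed.

HB.instance Definition _ k :=
  isMeasurableFun.Build _ _ _ _ (@cons_pair k) (@measurable_cons_pair k).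

Section Step.
Context (k : nat) (mu : {sigma_finite_measure set (k.-tuple T) -> \bar R}).

Definition lebesgue_cons : set (k.+1.-tuple T) -> \bar R :=
  pushforward (lebesgue_measure \x mu)%E (@cons_pair k).

Let lebesgue_cons0 : lebesgue_cons set0 = 0%E.
Proof. exact: measure0. Qed.

Let lebesgue_cons_ge0 A : (0 <= lebesgue_cons A)%E.
Proof. exact: measure_ge0. Qed.

Let lebesgue_cons_sigma_additive : semi_sigma_additive lebesgue_cons.
Proof. exact: measure_semi_sigma_additive. Qed.

HB.instance Definition _ := isMeasure.Build _ _ _ lebesgue_cons
  lebesgue_cons0 lebesgue_cons_ge0 lebesgue_cons_sigma_additive.

Let uncons (t : k.+1.-tuple T) : T * k.-tuple T :=
  (thead t, [tuple of behead t]).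

Let cons_pairK : cancel (@cons_pair k) uncons.
Proof. by move=> [x t]; congr pair; apply/val_inj. Qed.

Let measurable_uncons : measurable_fun [set: _] uncons.
Proof.
apply/measurable_fun_pairP; split.
  exact: (measurable_tnth ord0).
exact: measurable_behead.
Qed.

Lemma lebesgue_cons_sigma_finite : sigma_finite setT lebesgue_cons.
Proof.
have [F FT mF] : sigma_finite setT (lebesgue_measure \x mu)%E.
  (* the canonical instance on _ \x _ is the one for subprobabilities *)
  apply: isSigmaFinite.sigma_finiteT.
  exact: lebesgue_integral_fubini.measure_function_Measure_isSigmaFinite__to__measure_function_isSigmaFinite.
exists (fun i => uncons @^-1` F i).
  by rewrite -preimage_bigcup -FT preimage_setT.
move=> i; have [mFi Fioo] := mF i; split.
  by rewrite -[X in measurable X]setTI; exact: measurable_uncons.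
rewrite /lebesgue_cons /pushforward.
by rewrite (_ : _ @^-1` _ = F i)//; apply/seteqP; split=> p; rewrite /= cons_pairK.
Qed.

HB.instance Definition _ :=
  Measure_isSigmaFinite.Build _ _ _ lebesgue_cons lebesgue_cons_sigma_finite.

End Step.

(* Lebesgue measure on R^k, as the iterated product of lebesgue_measure *)
Fixpoint lebesgue_tuple k : {sigma_finite_measure set (k.-tuple T) -> \bar R} :=
  match k with
  | 0 => [the {sigma_finite_measure set (0.-tuple T) -> \bar R}
            of @dirac _ (0.-tuple T) [tuple] R]
  | k'.+1 => [the {sigma_finite_measure set (k'.+1.-tuple T) -> \bar R}
                of lebesgue_cons (lebesgue_tuple k')]
  end.

Lemma measurable_box k (A : 'I_k -> set T) : (forall i, measurable (A i)) ->
  measurable [set t : k.-tuple T | forall i, A i (tnth t i)].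
Proof.
move=> mA.
rewrite (_ : [set _ | _] = \bigcap_(i in [set: 'I_k]) ((@tnth k T)^~ i @^-1` A i)).
  apply: fin_bigcap_measurable => // i _.
  by rewrite -[X in measurable X]setTI; exact: measurable_tnth.
by apply/seteqP; split=> t /=; [move=> h i _; exact: h|move=> h i; exact: h].
Qed.

Lemma lebesgue_tuple_box k (A : 'I_k -> set T) : (forall i, measurable (A i)) ->
  lebesgue_tuple k [set t | forall i, A i (tnth t i)] =
  (\prod_(i < k) lebesgue_measure (A i))%E.
Proof.
elim: k A => [|k IH] A mA.
  rewrite big_ord0 /= diracE mem_set//= => -[]//.
rewrite big_ord_recl -IH; last by move=> i; exact: mA.
have mB := measurable_box (fun i => mA (lift ord0 i)).
rewrite -(product_measure1E _ _ (mA ord0) mB).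
rewrite /= /lebesgue_cons /pushforward; congr (product_measure1 _ _ _).
apply/seteqP; split=> -[x t] /=.
  move=> h; split; first exact: (h ord0).
  by move=> i; have := h (lift ord0 i); rewrite tnthS.
move=> [Ax h] i; case: (unliftP ord0 i) => [j ->|-> //].
by rewrite tnthS; exact: h.
Qed.

End LebesgueTuple.

Section Torus.
Context (R : realType) (n m : nat).
Local Notation T := (measurableTypeR R).

(* 'M[R]_(n, m) modulo integer matrices *)
Definition congr_int (X Y : 'M[R]_(n, m)) : bool := X - Y \is a mxOver Num.int.

Lemma congr_int_refl : reflexive congr_int.
Proof. by move=> X; apply/mxOverP => i j; rewrite !mxE subrr rpred0. Qed.

Lemma congr_int_sym : symmetric congr_int.
Proof.
move=> X Y; apply/mxOverP/mxOverP => h i j; have := h i j;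
  by rewrite !mxE -rpredN opprB.
Qed.

Lemma congr_int_trans : transitive congr_int.
Proof.
move=> Y X Z /mxOverP XY /mxOverP YZ; apply/mxOverP => i j.
by have := rpredD (XY i j) (YZ i j); rewrite !mxE subrKA.
Qed.

Canonical congr_int_equiv :=
  EquivRel congr_int congr_int_refl congr_int_sym congr_int_trans.

Definition torus := {eq_quot congr_int}%qT.

HB.instance Definition _ := Choice.on torus.
HB.instance Definition _ := EqQuotient.on torus.
HB.instance Definition _ := isPointed.Build torus (\pi_torus 0)%qT.

(* entry (i, j) of the matrix is coordinate mxvec_index i j of the tuple *)
Definition mx_of_tuple (t : (n * m).-tuple T) : 'M[R]_(n, m) :=
  \matrix_(i, j) tnth t (mxvec_index i j).

Definition torus_of_tuple (t : (n * m).-tuple T) : torus :=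
  (\pi_torus (mx_of_tuple t))%qT.

(* quotient sigma-algebra *)
Definition torus_measurable : set (set torus) :=
  [set A | measurable (torus_of_tuple @^-1` A)].

Lemma torus_measurable0 : torus_measurable set0.
Proof. by rewrite /torus_measurable /= preimage_set0. Qed.

Lemma torus_measurableC A : torus_measurable A -> torus_measurable (~` A).
Proof. by rewrite /torus_measurable /= preimage_setC; exact: measurableC. Qed.

Lemma torus_measurable_bigcup (F : (set torus)^nat) :
  (forall i, torus_measurable (F i)) -> torus_measurable (\bigcup_i F i).
Proof.
move=> mF; rewrite /torus_measurable /= preimage_bigcup.
by apply: bigcupT_measurable => i; exact: mF.
Qed.

HB.instance Definition _ := isMeasurable.Build default_measure_display torus
  torus_measurable0 torus_measurableC torus_measurable_bigcup.

Definition unit_cube k : set (k.-tuple T) :=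
  [set t | forall i, `[0, 1[%classic (tnth t i)].

Lemma measurable_unit_cube k : measurable (@unit_cube k).
Proof. by apply: (@measurable_box R k (fun=> `[0, 1[%classic)) => i; exact: measurable_itv. Qed.

(* a class meets [0, 1[^(n * m) in exactly one point, so this is the measure of
   the set of representatives lying in the cube *)
Definition torus_Leb : set torus -> \bar R :=
  pushforward (mrestr (lebesgue_tuple R (n * m)) (@measurable_unit_cube (n * m)))
    torus_of_tuple.

Lemma measurable_torus_of_tuple : measurable_fun [set: _] torus_of_tuple.
Proof. by move=> _ A mA; rewrite setTI. Qed.

HB.instance Definition _ :=
  isMeasurableFun.Build _ _ _ _ torus_of_tuple measurable_torus_of_tuple.

Let torus_Leb0 : torus_Leb set0 = 0%E.
Proof. exact: measure0. Qed.

Let torus_Leb_ge0 A : (0 <= torus_Leb A)%E.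
Proof. exact: measure_ge0. Qed.

Let torus_Leb_sigma_additive : semi_sigma_additive torus_Leb.
Proof. exact: measure_semi_sigma_additive. Qed.

HB.instance Definition _ := isMeasure.Build _ _ _ torus_Leb
  torus_Leb0 torus_Leb_ge0 torus_Leb_sigma_additive.

Lemma torus_LebT : torus_Leb setT = 1%E.
Proof.
rewrite /torus_Leb /pushforward preimage_setT /mrestr setTI.
rewrite (@lebesgue_tuple_box R _ (fun=> `[0, 1[%classic)).
  by rewrite big1// => i _; rewrite lebesgue_measure_itv /= lte01 oppr0 adde0.
by move=> i; exact: measurable_itv.
Qed.

HB.instance Definition _ :=
  Measure_isProbability.Build _ _ _ torus_Leb torus_LebT.

End Torus.

Section LinearForms.
Context (R : realType) (n m : nat).

(* the norm on 'rV[R]_m is the maximum norm *)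
Definition approximates (X : 'M[R]_(n, m)) (q : 'rV[nat]_n) (p : 'rV[int]_m)
    (e : R) : Prop :=
  `| map_mx (fun k => k%:R) q *m X - map_mx intr p | < e.

(* classes of the matrices X that have infinitely many good q; when P is constantly
   setT the condition on X does not depend on the representative *)
Definition W (P : 'rV[int]_n -> set 'rV[int]_m) (psi : 'rV[nat]_n -> R) :
    set (torus R n m) :=
  [set (\pi_(torus R n m) X)%qT | X in
    [set X | infinite_set
      [set q | exists2 p, P (map_mx Posz q) p & approximates X q p (psi q)]]].

Definition gcd_row (q : 'rV[nat]_n) : nat := \big[gcdn/0%N]_(j < n) q ord0 j.

(* poweR extends the power to +oo, so Psi takes values in [0, +oo] *)
Definition Psi (psi : 'rV[nat]_n -> R) (d : nat) : \bar R :=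
  ((\esum_(q in [set q | gcd_row q = d]) (psi q ^+ m)%:E) `^ (m%:R^-1))%E.

End LinearForms.

Lemma infinite_set_pickle (Q : countType) (A : set Q) :
  infinite_set A <-> forall N, exists2 q, (N <= pickle q)%N & A q.
Proof.
split=> [infA N|h finA].
  apply: contrapT => nA; apply: infA.
  apply: (@sub_finite_set _ _ (pickle @^-1` `I_N)).
    move=> q Aq /=; rewrite ltnNge; apply/negP => Nq; apply: nA.
    by exists q.
  apply: finite_preimage => [x y _ _|]; first exact: (pcan_inj pickleK).
  exact: finite_II.
have [k kA] : exists k, forall q, A q -> (pickle q < k)%N.
  have /finite_seqP[s As] := finA.
  exists (\max_(q <- s) pickle q).+1 => q Aq; rewrite ltnS.
  by apply: leq_bigmax_seq => //; move: Aq; rewrite As.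
by have [q kq /kA] := h k; rewrite ltnNge kq.
Qed.

Lemma measurable_bigcup_countable d (U : measurableType d) (Q : countType)
    (A : set Q) (F : Q -> set U) :
  (forall q, measurable (F q)) -> measurable (\bigcup_(q in A) F q).
Proof.
move=> mF; rewrite bigcup_mkcond.
apply: countable_bigcupT_measurable => // q.
by case: ifP => _; [exact: mF|exact: measurable0].
Qed.

Lemma measurable_W (R : realType) (n m : nat)
    (P : 'rV[int]_n -> set 'rV[int]_m) (psi : 'rV[nat]_n -> R) :
  measurable (W P psi).
Proof.
rewrite /measurable/= /torus_measurable /=.
pose E (Z : 'M[int]_(n, m)) q p := [set t : (n * m).-tuple (measurableTypeR R) |
  approximates (mx_of_tuple t + map_mx intr Z) q p (psi q)].
rewrite (_ : _ @^-1` _ = \bigcup_Z \bigcap_N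
    \bigcup_(q in [set q | (N <= pickle q)%N])
    \bigcup_(p in P (map_mx Posz q)) E Z q p); last first.
  apply/seteqP; split=> t /=.
    move=> [X infX /(@eqquotP _ _ (torus R n m))/mxOverP XtZ].
    pose Z := (\matrix_(i, j) Num.floor ((X - mx_of_tuple t) i j)).
    have XE : X = mx_of_tuple t + map_mx intr Z.
      apply/matrixP => i j; have := XtZ i j.
      by rewrite !mxE => /floorK ->; rewrite subrKC.
    exists Z => // N _; have /infinite_set_pickle/(_ N)[q Nq [p Pp Xp]] := infX.
    by exists q => //; exists p => //; rewrite /E /= -XE.
  move=> [Z _ h]; exists (mx_of_tuple t + map_mx intr Z).
    apply/infinite_set_pickle => N; have [q Nq [p Pp Ep]] := h N I.
    by exists q => //; exists p.
  apply/(@eqquotP _ _ (torus R n m))/mxOverP => i j.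
  by rewrite !mxE [X in X - _]addrC addrK intr_int.
have mE Z q p : measurable (E Z q p).
  pose f (i : 'I_m) (t : (n * m).-tuple (measurableTypeR R)) : R :=
    (map_mx (fun k => k%:R) q *m (mx_of_tuple t + map_mx intr Z)
      - map_mx intr p) ord0 i.
  have mf i : measurable_fun setT (f i).
    rewrite [X in measurable_fun _ X](_ : _ = fun t => \sum_(k < n)
      (q ord0 k)%:R * (tnth t (mxvec_index k i) + (Z k i)%:~R) - (p ord0 i)%:~R).
      apply: measurable_funB => //; apply: measurable_sum => k.
      apply: measurable_funM => //; apply: measurable_funD => //.
      exact: measurable_tnth.
    apply/funext => t; rewrite /f !mxE; congr (_ - _).
    by apply: eq_bigr => k _; rewrite !mxE.
  have [psi_gt0|psi_le0] := ltP 0 (psi q); last first.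
    rewrite (_ : E Z q p = set0)//; apply/seteqP; split=> t //.
    by move=> /(le_lt_trans (normr_ge0 _)); rewrite ltNge psi_le0.
  rewrite (_ : E Z q p =
      \bigcap_(i in [set: 'I_m]) [set t | `|f i t| < psi q]).
    apply: fin_bigcap_measurable => // i _.
    rewrite (_ : [set _ | _] = f i @^-1` ball 0 (psi q)).
      by rewrite -[X in measurable X]setTI; apply: mf => //; exact: measurable_ball.
    by apply/seteqP; split=> t; rewrite /ball /= sub0r normrN.
  apply/seteqP; split=> t; rewrite /E /approximates /= [Num.norm _]/Num.norm /= mx_normrE.
    by move=> /bigmax_ltP[_ h] i _; exact: (h (ord0, i)).
  by move=> h; apply/bigmax_ltP; split=> // -[i j] _ /=; rewrite (ord1 i); exact: h.
apply: measurable_bigcup_countable => Z; apply: bigcapT_measurable => N.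
by do 2!apply: measurable_bigcup_countable => ?.
Qed.

(* Main.v *)
(** The convergence part is the Borel-Cantelli lemma.

    For divergence, let A(q) be the set of X for which every entry of qX is within
    s(q) = min(psi(q), 1/2) of an integer coprime to d = gcd(q), where only those d
    with \sum_(p | d) 1/p <= 7/8 are kept. As Psi is nonincreasing and the sum over
    p is at most 3/4 on average, Abel summation shows that \sum_q s(q)^m still
    diverges over the remaining q. Averaging over translations of X by w^T t, with w
    an integer vector and t in [0, 1]^m, gives |A(q)| << s(q)^m as well as
    |A(q) /\ A(r)| << (s(q) s(r))^m for q <> r: when q and r are not parallel take w
    orthogonal to q only, and otherwise the coprime numerators exclude coinciding
    fractions.

    Let B be the set of X lying in no A(q) with q beyond some point. Small
    translations of B meet A(q) in average proportion at least c s(q)^m, whereas B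
    does not; since |(B + h) \ B| tends to 0 with h, comparison with the second
    moment of \sum_q 1_A(q) forces |B| = 0. *)

From HB Require Import structures.
Require Import Defs.
From mathcomp Require Import finmap all_boot all_order all_algebra.
From mathcomp Require Import all_classical all_reals all_analysis measurable_realfun.
From mathcomp Require Import zify ring lra.
Import Order.TTheory GRing.Theory Num.Theory.
Import numFieldNormedType.Exports.
Local Open Scope classical_set_scope.
Local Open Scope ring_scope.
Set Implicit Arguments.
Unset Strict Implicit.
Unset Printing Implicit Defensive.

(** * Translations of periodic functions on the line *)

(** The obstacle is to have small overlaps and a local lower bound together. If all numerators were
    allowed, parallel vectors q = d v and r = e v would share the fractions whose denominator
    divides gcd(d, e), and the overlap of their sets could exceed the product bound. Coprime
    numerators remove this excess, but keep only a proportion phi(d) / d of them, which can be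
    arbitrarily small. For the retained d, at least L / 8 - omega(d) of any L consecutive integers
    are coprime to d, omega(d) being the number of prime divisors, which is O(sqrt d). Hence a
    translation that moves the entries of qX over a stretch long compared with sqrt d already meets
    a fixed proportion of good numerators, whatever its starting point. Monotonicity of Psi enters
    solely in passing to the retained d. *)

Section Line.
Context (R : realType).
Local Notation T := (measurableTypeR R).
Implicit Types (h : R) (A : set T) (f : T -> \bar R).

Lemma measurable_addr h : measurable_fun [set: T] (fun x : T => x + h : T).
Proof. by apply: measurable_funD. Qed.

Lemma lebesgue_measure_addr h A : measurable A ->
  lebesgue_measure [set x | A (x + h)] = lebesgue_measure A.
Proof.
move=> mA; pose add := (fun x : T => x + h : T).
pose add_mixin := isMeasurableFun.Build _ _ _ _ add (measurable_addr h).
pose addm : {mfun T >-> T} := HB.pack add add_mixin.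
symmetry; rewrite -[RHS]/(pushforward lebesgue_measure addm A).
apply: lebesgue_measure_unique mA => _ [[a b] _ <-]/=.
rewrite /pushforward.
rewrite (_ : _ @^-1` _ = `]a - h, b - h]%classic).
  rewrite !lebesgue_measure_itv/= !lte_fin ltrD2r.
  by case: ifP => // _; rewrite -!EFinD; congr EFin; ring.
by apply/seteqP; split=> x; rewrite /= !in_itv/= ltrBlDr lerBrDr.
Qed.

Lemma ge0_integral_addr h (D : set T) f : measurable D -> measurable_fun [set: T] f ->
  (forall x, 0 <= f x)%E ->
  (\int[lebesgue_measure]_(x in [set x | D (x + h)%R]) f (x + h)%R =
   \int[lebesgue_measure]_(x in D) f x)%E.
Proof.
move=> mD mf f0.
rewrite -(ge0_integral_pushforward (measurable_addr h) _ mD) //.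
- apply: eq_measure_integral => [|madd A mA _]; first exact: measurable_addr.
  exact: lebesgue_measure_addr.
- exact: measurable_funS mf.
Qed.

Definition periodic1 (f : T -> \bar R) := forall x z, z \is a Num.int -> f (x + z) = f x.

Lemma ge0_integral_periodic h f : measurable_fun [set: T] f -> (forall x, 0 <= f x)%E ->
  periodic1 f ->
  (\int[lebesgue_measure]_(x in `[0%R, 1%R[) f (x + h)%R =
   \int[lebesgue_measure]_(x in `[0%R, 1%R[) f x)%E.
Proof.
move=> mf f0 pf.
(* Periodicity reduces h to its fractional part. Then [h, 1 + h[ and [0, 1[ share [h, 1[, and the
   remaining pieces [1, 1 + h[ and [0, h[ differ by the translation by 1. *)
wlog /andP[h0 h1] : h / 0 <= h < 1.
  move=> H; rewrite -(H (h - (Num.floor h)%:~R)); last first.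
    have := Num.Theory.floorD1_gt h; have := Num.Theory.floor_le h; rewrite intrD; lra.
  by apply: eq_integral => x _; rewrite addrA (pf (x + h)) // rpredN intr_int.
have intE (a b c : R) : (\int[lebesgue_measure]_(x in `[a, b[) f (x + c)%R =
   \int[lebesgue_measure]_(x in `[(a + c)%R, (b + c)%R[) f x)%E.
  rewrite -(ge0_integral_addr c (D := `[a + c, b + c[%classic)) //.
  congr integral; apply/seteqP; split=> x /=; by rewrite !in_itv/= lerD2r ltrD2r.
have split3 (a b c : R) : a <= b -> b <= c ->
    (\int[lebesgue_measure]_(x in `[a, c[) f x =
   \int[lebesgue_measure]_(x in `[a, b[) f x + \int[lebesgue_measure]_(x in `[b, c[) f x)%E.
  move=> ab bc; rewrite -ge0_integral_setU //=; first last.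
  - apply/disj_setPLR => x /=; rewrite !in_itv/= => /andP[? ?] /andP[? _]; lra.
  - exact: measurable_funS mf.
  - congr integral; apply/seteqP; split=> x /=; rewrite !in_itv/=.
      by case: (ltP x b) => ? /andP[-> ->]; [left|right].
    by case=> /andP[? ?]; apply/andP; split; lra.
rewrite intE add0r (split3 h 1 (1 + h)); [|lra|lra].
rewrite (split3 0 h 1); [|lra|lra].
rewrite addeC; congr (_ + _)%E.
rewrite -{1}[1]add0r [(1 + h)%R]addrC -intE.
by apply: eq_integral => x _; rewrite pf.
Qed.

End Line.

(** * Translations in Lebesgue measure on tuples *)

Section Tuples.
Context (R : realType).
Local Notation T := (measurableTypeR R).
Local Notation leb := (lebesgue_tuple R).

Definition tadd k (X h : k.-tuple T) : k.-tuple T :=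
  [tuple tnth X i + tnth h i | i < k].

Lemma tnth_tadd k (X h : k.-tuple T) i : tnth (tadd X h) i = tnth X i + tnth h i.
Proof. by rewrite tnth_mktuple. Qed.

Lemma measurable_tadd k d (U : measurableType d) (f g : U -> k.-tuple T) :
  measurable_fun [set: U] f -> measurable_fun [set: U] g ->
  measurable_fun [set: U] (fun u => tadd (f u) (g u)).
Proof.
move=> /measurable_fun_tnthP mf /measurable_fun_tnthP mg.
apply/measurable_fun_tnthP => i.
rewrite (_ : _ \o _ = fun u => (tnth (f u) i : T) + tnth (g u) i); last first.
  by apply/funext => u /=; rewrite tnth_tadd.
by apply: measurable_funD; [exact: mf|exact: mg].
Qed.

Lemma measurable_preimage_tadd k (h : k.-tuple T) (E : set (k.-tuple T)) :
  measurable E -> measurable [set t | E (tadd t h)].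
Proof.
move=> mE; rewrite -[X in measurable X]setTI.
by apply: (@measurable_tadd k _ _ id (cst h)) => //; exact: measurable_cst.
Qed.

Lemma tadd_cons k x (t : k.-tuple T) y s :
  tadd (cons_pair (x, t)) (cons_pair (y, s)) = cons_pair (x + y, tadd t s).
Proof.
apply: eq_from_tnth => i; rewrite tnth_tadd.
by case: (unliftP ord0 i) => [j ->|->]; rewrite ?tnthS ?tnth_tadd.
Qed.

Lemma cons_pair_eta k (h : k.+1.-tuple T) :
  h = cons_pair (thead h, [tuple of behead h]).
Proof. by rewrite [LHS]tuple_eta; apply: val_inj. Qed.

Lemma measurable_cons_section k x (E : set (k.+1.-tuple T)) :
  measurable E -> measurable [set t : k.-tuple T | E (cons_pair (x, t))].
Proof.
move=> mE; rewrite -[X in measurable X]setTI.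
apply: (measurableT_comp (measurable_cons_pair (k := k)) (pair1_measurable x)) => //.
Qed.

Lemma lebesgue_tupleS k (E : set (k.+1.-tuple T)) :
  leb k.+1 E = (\int[lebesgue_measure]_x leb k [set t | E (cons_pair (x, t))])%E.
Proof.
rewrite /= /lebesgue_cons /pushforward /product_measure1.
apply: eq_integral => x _ /=; congr (leb k _).
by apply/seteqP; split=> t; rewrite /xsection /= inE.
Qed.

Lemma measurable_lebesgue_tuple_section k (E : set (k.+1.-tuple T)) : measurable E ->
  measurable_fun [set: T] (fun x => leb k [set t | E (cons_pair (x, t))]).
Proof.
move=> mE.
rewrite (_ : (fun _ => _) =
    leb k \o xsection ((@cons_pair R k) @^-1` E)).
  apply: measurable_fun_xsection.
  by rewrite -[X in measurable X]setTI; exact: measurable_cons_pair.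
apply/funext => x /=; congr (leb k _).
by apply/seteqP; split=> t; rewrite /xsection /= inE.
Qed.

Lemma lebesgue_tuple_tadd k (h : k.-tuple T) (E : set (k.-tuple T)) :
  measurable E -> leb k [set t | E (tadd t h)] = leb k E.
Proof.
elim: k h E => [|k IH] h E mE.
  by rewrite (_ : [set _ | _] = E)//; apply/funext => t /=; congr E; apply: eq_from_tnth => -[].
rewrite 2!lebesgue_tupleS [h]cons_pair_eta.
transitivity (\int[lebesgue_measure]_x
    leb k [set t | E (cons_pair ((x + thead h)%R, t))])%E.
  apply: eq_integral => x _.
  rewrite -[RHS](IH [tuple of behead h]); last exact: measurable_cons_section.
  by congr (leb k _); apply/seteqP; split=> t; rewrite /= tadd_cons.
rewrite -[RHS](ge0_integral_addr (thead h) measurableT) //.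
exact: measurable_lebesgue_tuple_section.
Qed.

Definition periodic k (E : set (k.-tuple T)) :=
  forall X Y : k.-tuple T, (forall i, tnth X i - tnth Y i \is a Num.int) -> E X -> E Y.

Lemma unit_cube_cons k x (t : k.-tuple T) :
  unit_cube (cons_pair (x, t)) <-> `[0, 1[%classic x /\ unit_cube t.
Proof.
split=> [h|[hx ht] i].
  by split=> [|i]; [exact: (h ord0)|have := h (lift ord0 i); rewrite tnthS].
by case: (unliftP ord0 i) => [j ->|-> //]; rewrite tnthS.
Qed.

Lemma lebesgue_cubeS k (E : set (k.+1.-tuple T)) :
  leb k.+1 (E `&` @unit_cube R k.+1) = (\int[lebesgue_measure]_(x in `[0%R, 1%R[)
    leb k ([set t | E (cons_pair (x, t))] `&` @unit_cube R k))%E.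
Proof.
rewrite lebesgue_tupleS [RHS]integral_mkcond; apply: eq_integral => x _.
rewrite patchE; case: ifPn => [/set_mem x01|/negP x01].
  congr (leb k _); apply/seteqP; split=> t [Et /=].
    by move=> /unit_cube_cons[].
  by move=> ct; split=> //; apply/unit_cube_cons.
rewrite (_ : [set _ | _] = set0) ?measure0 //.
apply/seteqP; split=> t //= -[_ /unit_cube_cons[x01' _]].
by apply: x01; rewrite inE.
Qed.

Lemma periodic_cons k x (E : set (k.+1.-tuple T)) :
  periodic E -> periodic [set t | E (cons_pair (x, t))].
Proof.
move=> pE X Y XY; apply: pE => i.
by case: (unliftP ord0 i) => [j ->|->]; rewrite ?tnthS //= subrr rpred0.
Qed.

(** Translation invariance of the measure on the torus, read on the fundamental cube: the induction
    hypothesis translates the tails of the sections, and the one-dimensional case translates the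
    first coordinate. *)
Lemma lebesgue_cube_tadd k (h : k.-tuple T) (E : set (k.-tuple T)) :
  measurable E -> periodic E ->
  leb k ([set t | E (tadd t h)] `&` @unit_cube R k) = leb k (E `&` @unit_cube R k).
Proof.
elim: k h E => [|k IH] h E mE pE.
  by rewrite (_ : [set _ | _] = E)//; apply/funext => t /=; congr E; apply: eq_from_tnth => -[].
rewrite 2!lebesgue_cubeS [h]cons_pair_eta.
pose g x := leb k ([set t | E (cons_pair (x, t))] `&` @unit_cube R k).
transitivity (\int[lebesgue_measure]_(x in `[0%R, 1%R[) g (x + thead h)%R)%E.
  apply: eq_integral => x _; rewrite /g.
  rewrite -[RHS](IH [tuple of behead h]) //; first last.
  - exact: periodic_cons.
  - exact: measurable_cons_section.
  by congr (leb k _); apply/seteqP; split=> t [/=]; rewrite tadd_cons.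
apply: ge0_integral_periodic => //.
(* Imposing the cube condition on the tail only makes [g] the section function of one measurable
   set. *)
- rewrite (_ : g = fun x => leb k [set t |
      (E `&` [set s | unit_cube (behead_tuple (s : k.+1.-tuple T))]) (cons_pair (x, t))]).
    apply: measurable_lebesgue_tuple_section; apply: measurableI => //.
    rewrite -[X in measurable X]setTI; apply: measurable_behead => //.
    exact: measurable_unit_cube.
  apply/funext => x; congr (leb k _); apply/seteqP.
  have eq_t (t : k.-tuple T) : behead_tuple (cons_pair (x, t)) = t by apply: val_inj.
  by split=> t [/= Et ct]; split=> //; move: ct; rewrite /= eq_t.
- move=> x z zint; rewrite /g; congr (leb k _).
  have Exz y (t : k.-tuple T) w : w \is a Num.int -> E (cons_pair (y, t)) ->
    E (cons_pair (y + w, t)).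
    move=> wint; apply: pE => i.
    by case: (unliftP ord0 i) => [j ->|->];
      rewrite ?tnthS ?subrr ?rpred0 //= opprD addrA subrr sub0r rpredN.
  apply/seteqP; split=> t [/= Et ct]; split=> //=; last exact: Exz.
  by rewrite -[x](addrK z); apply: Exz; rewrite ?rpredN.
Qed.

End Tuples.

(** * Tonelli's theorem for sets and continuity of translations *)

Section TonelliSets.
Local Open Scope ereal_scope.
Context (R : realType) d1 d2 (X : measurableType d1) (Y : measurableType d2).
Context (m1 : {sigma_finite_measure set X -> \bar R})
        (m2 : {sigma_finite_measure set Y -> \bar R}).

Lemma tonelli_set (G : set (X * Y)) : measurable G ->
  \int[m1]_x m2 [set y | G (x, y)] = \int[m2]_y m1 [set x | G (x, y)].
Proof.
move=> mG; have := indic_fubini_tonelli m1 m2 mG.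
rewrite indic_fubini_tonelli_FE// indic_fubini_tonelli_GE//= => GE.
rewrite [LHS](_ : _ = \int[m1]_x m2 (xsection G x)); last first.
  by apply: eq_integral => x _; congr (m2 _); apply/seteqP; split=> y; rewrite /xsection /= inE.
rewrite [RHS](_ : _ = \int[m2]_y m1 (ysection G y)) //.
by apply: eq_integral => x _; congr (m1 _); apply/seteqP; split=> y; rewrite /ysection /= inE.
Qed.

Lemma measurable_fun_measure_xsection (G : set (X * Y)) : measurable G ->
  measurable_fun [set: X] (fun x => m2 [set y | G (x, y)]).
Proof.
move=> mG; rewrite (_ : (fun _ => _) = m2 \o xsection G).
  exact: measurable_fun_xsection.
by apply/funext => x /=; congr (m2 _); apply/seteqP; split=> y; rewrite /xsection /= inE.
Qed.

Lemma measurable_fun_measure_ysection (G : set (X * Y)) : measurable G ->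
  measurable_fun [set: Y] (fun y => m1 [set x | G (x, y)]).
Proof.
move=> mG; rewrite (_ : (fun _ => _) = m1 \o ysection G).
  exact: measurable_fun_ysection.
by apply/funext => x /=; congr (m1 _); apply/seteqP; split=> y; rewrite /ysection /= inE.
Qed.

Lemma ge0_integral_support d (Z : measurableType d) (mu : {measure set Z -> \bar R})
    (A : set Z) (f : Z -> \bar R) : (forall z, ~ A z -> f z = 0) ->
  \int[mu]_z f z = \int[mu]_(z in A) f z.
Proof.
move=> f0; rewrite [RHS]integral_mkcond; apply: eq_integral => z _.
by rewrite patchE; case: ifPn => // /negP; rewrite inE => /f0.
Qed.

Lemma tonelli_set_le (G : set (X * Y)) (A : set X) (c : \bar R) :
  measurable G -> measurable A -> (forall x y, G (x, y) -> A x) -> 0 <= c ->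
  (forall x, m2 [set y | G (x, y)] <= c) ->
  \int[m2]_y m1 [set x | G (x, y)] <= c * m1 A.
Proof.
move=> mG mA GA c0 Gc; rewrite -tonelli_set// (@ge0_integral_support _ _ _ A).
  rewrite -integral_cst//; apply: ge0_le_integral => //.
  by apply: measurable_funTS; exact: measurable_fun_measure_xsection.
move=> x Ax; rewrite (_ : [set _ | _] = set0) ?measure0//.
by apply/seteqP; split=> y //= /GA.
Qed.

(** Double counting: fibres over points of [A] are large, while the total of the fibres over a point
    of [B] is at most [b]. In the application [X] carries the matrices and [Y] the translation
    parameters. *)
Lemma tonelli_set_sum_ge (I : eqType) (s : seq I) (G : I -> set (X * Y))
    (A : set X) (B : set Y) (c : I -> \bar R) (b : \bar R) :
  (forall i, measurable (G i)) -> measurable A -> measurable B ->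
  (forall i x y, G i (x, y) -> B y) -> 0 <= b ->
  (forall i, i \in s -> 0 <= c i) ->
  (forall i x, i \in s -> A x -> c i <= m2 [set y | G i (x, y)]) ->
  (forall y, B y -> \sum_(i <- s) m1 [set x | G i (x, y)] <= b) ->
  (\sum_(i <- s) c i) * m1 A <= b * m2 B.
Proof.
move=> mG mA mB GB b0 c0 Gc Gb.
apply: (@le_trans _ _ (\sum_(i <- s) \int[m2]_y m1 [set x | G i (x, y)])).
  rewrite big_seq ge0_sume_distrl; last by move=> i /c0.
  rewrite [leRHS]big_seq; apply: lee_sum => i si.
  rewrite -integral_cst// -tonelli_set//.
  apply: (@le_trans _ _ (\int[m1]_(x in A) m2 [set y | G i (x, y)])).
    apply: ge0_le_integral => //; first by move=> x _; exact: c0.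
      by apply: measurable_funTS; exact: measurable_fun_measure_xsection.
    by move=> x Ax; exact: Gc.
  by apply: ge0_subset_integral => //; exact: measurable_fun_measure_xsection.
rewrite -ge0_integral_sum//; last by move=> i; exact: measurable_fun_measure_ysection.
rewrite (@ge0_integral_support _ _ _ B); last first.
  move=> y By; rewrite big1// => i _; rewrite (_ : [set _ | _] = set0) ?measure0//.
  by apply/seteqP; split=> x //= /GB.
rewrite -integral_cst//; apply: ge0_le_integral => //.
  by move=> y _; apply: sume_ge0.
by apply: measurable_funTS; apply: emeasurable_sum => i; exact: measurable_fun_measure_ysection.
Qed.

End TonelliSets.

Section TranslateContinuity.
Context (R : realType).
Local Notation T := (measurableTypeR R).
Local Notation leb := (lebesgue_tuple R).

Definition box k (D : set T) : set (k.-tuple T) := [set t | forall i, D (tnth t i)].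

Arguments box k D : clear implicits.

Lemma measurable_box_cst k D : measurable D -> measurable (box k D).
Proof. by move=> mD; exact: (measurable_box (fun=> mD)). Qed.

Lemma lebesgue_tuple_box_itv k (r : R) : 0 <= r ->
  leb k (box k `[0, r[%classic) = (r ^+ k)%:E.
Proof.
move=> r0; rewrite (@lebesgue_tuple_box R k (fun=> `[0, r[%classic)) //.
rewrite (eq_bigr (fun=> r%:E)) => [|i _]; last first.
  by rewrite lebesgue_measure_itv/= lte_fin oppr0 adde0; case: ltgtP r0 => // <-.
by rewrite -[k in RHS]card_ord -prodr_const -prodEFin.
Qed.

Lemma lebesgue_cube_coord_le k (i : 'I_k) (J : set T) : measurable J ->
  (leb k ([set t | J (tnth t i)] `&` @unit_cube R k) <= lebesgue_measure J)%E.
Proof.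
move=> mJ; pose A j := if j == i then J else `[0, 1[%classic : set T.
have mA j : measurable (A j) by rewrite /A; case: ifP.
apply: (@le_trans _ _ (leb k [set t | forall j, A j (tnth t j)])).
  apply: le_measure; rewrite ?inE; last by move=> t [Jt ct] j; rewrite /A; case: eqP => [->|_].
  - apply: measurableI; last exact: measurable_unit_cube.
    by rewrite -[X in measurable X]setTI; exact: measurable_tnth.
  - exact: measurable_box.
rewrite lebesgue_tuple_box// (bigD1 i)//= big1 ?mule1 /A ?eqxx//.
move=> j /negPf ->; rewrite lebesgue_measure_itv/= lte_fin ltr01 oppr0 adde0//.
Qed.

Definition translation_defect k (B : set (k.-tuple T)) h : set (k.-tuple T) :=
  [set X | ~ (B X <-> B (tadd X h))].

Definition small_translation k (B : set (k.-tuple T)) := forall eps : R, 0 < eps ->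
  exists2 delta, 0 < delta <= 1 & forall h, box k `[0, delta[%classic h ->
    (leb k (translation_defect B h `&` @unit_cube R k) <= eps%:E)%E.

Lemma measurable_translation_defect k (B : set (k.-tuple T)) h : measurable B ->
  measurable (translation_defect B h).
Proof.
move=> mB; rewrite (_ : translation_defect B h =
    (B `\` [set t | B (tadd t h)]) `|` ([set t | B (tadd t h)] `\` B)).
  have mBh := measurable_preimage_tadd h mB.
  by apply: measurableU; apply: measurableD.
apply/seteqP; split=> X; rewrite /translation_defect /=.
  move=> nB; case: (pselect (B X)) => BX; [left|right]; split=> //.
    by move=> Bh; apply: nB; split.
  by apply: contrapT => Bh; apply: nB; split.
by case=> -[? ?] []; tauto.
Qed.

Lemma small_translationC k (B : set (k.-tuple T)) :
  small_translation B -> small_translation (~` B).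
Proof.
move=> sB eps e0; have [delta d0 H] := sB eps e0; exists delta => // h /H.
rewrite (_ : translation_defect (~` B) h = translation_defect B h)//.
apply/seteqP; split=> X; rewrite /translation_defect /=; by tauto.
Qed.

Lemma small_translationU k (B C : set (k.-tuple T)) : measurable B -> measurable C ->
  small_translation B -> small_translation C -> small_translation (B `|` C).
Proof.
move=> mB mC sB sC eps e0; have e2 : 0 < eps / 2 by rewrite divr_gt0.
have [d1 /andP[d10 d11] H1] := sB _ e2; have [d2 /andP[d20 d21] H2] := sC _ e2.
exists (Num.min d1 d2); first by rewrite lt_min d10 d20 ge_min d11.
move=> h hh; have h1 : box k `[0, d1[%classic h.
  by move=> i; have := hh i; rewrite /= !in_itv/= lt_min => /and3P[-> ->].
have h2 : box k `[0, d2[%classic h.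
  by move=> i; have := hh i; rewrite /= !in_itv/= lt_min => /and3P[-> _ ->].
have mc := @measurable_unit_cube R k.
apply: (@le_trans _ _ (leb k ((translation_defect B h `&` @unit_cube R k) `|`
    (translation_defect C h `&` @unit_cube R k)))).
  apply: le_measure; rewrite ?inE.
  - by apply: measurableI => //; apply: measurable_translation_defect; exact: measurableU.
  - by apply: measurableU; apply: measurableI => //; exact: measurable_translation_defect.
  - move=> X [+ cX]; rewrite /translation_defect /= => nX.
    case: (pselect (B X <-> B (tadd X h))) => BX; last by left.
    by right; split=> // CX; apply: nX; tauto.
rewrite (splitr eps) EFinD; apply: le_trans (leeD (H1 _ h1) (H2 _ h2)).
by apply: measureU2; apply: measurableI => //; exact: measurable_translation_defect.
Qed.

(** A point of the defect of the union lies in the defect of a finite subunion, or else the point or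
    its translate lies in the remaining tail, whose measure is small. *)
Lemma small_translation_bigcup k (F : (set (k.-tuple T))^nat) :
  (forall i, measurable (F i)) -> (forall i, small_translation (F i)) ->
  small_translation (\bigcup_i F i).
Proof.
move=> mF sF eps e0; have e3 : 0 < eps / 3 by rewrite divr_gt0.
pose G n := \bigcup_(i < n) F i.
have mG n : measurable (G n) by apply: bigcup_measurable => i _.
have mU : measurable (\bigcup_i F i) by exact: bigcup_measurable.
have sG n : small_translation (G n).
  rewrite /G; elim: n => [|n IH].
    rewrite II0 bigcup_set0 => e ?; exists 1; rewrite ?ltr01 ?lexx// => h _.
    rewrite (_ : _ `&` _ = set0) ?measure0 ?lee_fin ?ltW//.
    by apply/seteqP; split=> X // [+ _]; apply.
  by rewrite bigcup_mkord big_ord_recr/= -bigcup_mkord; apply: small_translationU => //;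
    exact: (mG n).
(* [Q] contains the cube and its translates by [h] with coordinates in [0, 1[. Its finite measure
   allows continuity from above for the tails [H n]. *)
pose Q := box k `[0, 2%:R[%classic.
have mQ : measurable Q by exact: measurable_box_cst.
pose H n := Q `&` (\bigcup_i F i `\` G n).
have mH n : measurable (H n) by apply: measurableI => //; exact: measurableD.
have [n Hn] : exists n, (leb k (H n) <= (eps / 3)%:E)%E.
  have cH : ((leb k \o H) n @[n --> \oo] --> leb k (\bigcap_n H n))%classic.
    apply: nonincreasing_cvg_mu => //.
    - apply: (@le_lt_trans _ _ (leb k Q)); last by rewrite lebesgue_tuple_box_itv// ltry.
      by apply: le_measure; rewrite ?inE//; apply: subIsetl.
    - exact: bigcapT_measurable.
    - move=> a b ab; apply/subsetPset => X [QX [UX GX]]; split=> //; split=> //.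
      by move=> [i ia Fi]; apply: GX; exists i => //; exact: leq_trans ab.
  have cap0 : (leb k (\bigcap_n H n) < (eps / 3)%:E)%E.
    rewrite (_ : \bigcap_n _ = set0) ?measure0 ?lte_fin//.
    apply/seteqP; split=> X // HX; have [_ [[i _ Fi] _]] := HX 0%N I.
    by have [_ [_]] := HX i.+1 I; apply; exists i => /=.
  have [n _ /(_ n (leqnn n))/= Hn] := cH _ (open_ereal_lt' cap0).
  by exists n; exact: ltW.
have [delta d01 Hd] := sG n _ e3; exists delta => // h hh.
have mc := @measurable_unit_cube R k.
have mHh : measurable [set t | H n (tadd t h)] by exact: measurable_preimage_tadd.
have mGh : measurable (translation_defect (G n) h `&` @unit_cube R k).
  by apply: measurableI => //; apply: measurable_translation_defect.
apply: (@le_trans _ _ (leb k (((translation_defect (G n) h `&` @unit_cube R k) `|` H n)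
    `|` [set t | H n (tadd t h)]))).
  apply: le_measure; rewrite ?inE.
  - by apply: measurableI => //; exact: measurable_translation_defect.
  - by apply: measurableU => //; exact: measurableU.
  - move=> X [+ cX]; rewrite /translation_defect /= => nX.
    have [d0 d1] := andP d01.
    have QX : Q X by move=> i; have := cX i; rewrite /= !in_itv/=; lra.
    have QXh : Q (tadd X h).
      move=> i; have := cX i; have := hh i.
      by rewrite /= !in_itv/= tnth_tadd => /andP[? ?] /andP[? ?]; apply/andP; split; lra.
    have GU Y : G n Y -> (\bigcup_i F i) Y by move=> [i _ ?]; exists i.
    case: (pselect (G n X <-> G n (tadd X h))) => GX; last by left; left.
    case: (pselect (G n X)) => [GnX|nGX].
      by exfalso; apply: nX; split=> _; apply: GU => //; apply/GX.
    have nGXh : ~ G n (tadd X h) by move=> /GX.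
    case: (pselect ((\bigcup_i F i) X)) => UX; first by left; right.
    right; split=> //; split=> //; apply: contrapT => UXh; apply: nX; tauto.
rewrite (_ : eps = eps / 3 + eps / 3 + eps / 3); last by field.
have Hnh : (leb k [set t | H n (tadd t h)] <= (eps / 3)%:E)%E.
  by rewrite lebesgue_tuple_tadd.
rewrite 2!EFinD; apply: le_trans (leeD (leeD (Hd _ hh) Hn) Hnh).
apply: (le_trans (measureU2 _ _ _)) => //; first exact: measurableU.
by apply: leeD => //; exact: measureU2.
Qed.

(** The measurable sets with the property form a sigma-algebra. Generation is used twice: by
    preimages under coordinates, then on the line by half-open intervals. *)
Lemma small_translation_measurable k (B : set (k.-tuple T)) :
  measurable B -> small_translation B.
Proof.
move=> mB; suff: [set A | measurable A /\ small_translation A] B by case.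
move: B mB; apply: smallest_sub.
  split.
  - split=> // e e0; exists 1; rewrite ?ltr01 ?lexx// => h _.
    rewrite (_ : _ `&` _ = set0) ?measure0 ?lee_fin ?ltW//.
    by apply/seteqP; split=> X // [+ _]; apply.
  - move=> A [mA sA]; rewrite setTD; split; first exact: measurableC.
    exact: small_translationC.
  - move=> F HF; split; first by apply: bigcupT_measurable => i; have [] := HF i.
    by apply: small_translation_bigcup => i; have [] := HF i.
rewrite -bigcup_seq; apply: bigcup_sub => i _ _ [Y mY <-]; rewrite setTI.
suff H (Y' : set T) : measurable Y' ->
    measurable Y' /\ small_translation ((fun t : k.-tuple T => tnth t i) @^-1` Y').
  split; last by have [] := H _ mY.
  by rewrite -[X in measurable X]setTI; exact: measurable_tnth.
have mpre (Z : set T) : measurable Z -> measurable ((fun t : k.-tuple T => tnth t i) @^-1` Z).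
  by move=> mZ; rewrite -[X in measurable X]setTI; exact: measurable_tnth.
move: Y'; apply: smallest_sub.
  split.
  - split=> // e e0; exists 1; rewrite ?ltr01 ?lexx// => h _.
    rewrite (_ : _ `&` _ = set0) ?measure0 ?lee_fin ?ltW//.
    by apply/seteqP; split=> X // [+ _]; apply.
  - move=> A [mA sA]; rewrite setTD; split; first exact: measurableC.
    by rewrite preimage_setC; exact: small_translationC.
  - move=> F HF; split; first by apply: bigcupT_measurable => j; have [] := HF j.
    rewrite preimage_bigcup; apply: small_translation_bigcup => j.
      by apply: mpre; have [] := HF j.
    by have [] := HF j.
move=> _ [[a b] _ <-]/=; split; first exact: measurable_itv.
move=> e e0; exists (Num.min 1 (e / 2)).
  by rewrite lt_min ltr01 divr_gt0//= ge_min lexx.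
move=> h hh; have := hh i; rewrite /= in_itv/= lt_min => /and3P[h0 h1 he].
set B := (_ @^-1` _).
have mc := @measurable_unit_cube R k.
(* The shift changes membership in ]a, b] only if it carries the coordinate across [a] or [b]. *)
pose J a : set T := `]a - tnth h i, a]%classic.
have mB : measurable B by apply: mpre; exact: measurable_itv.
have mJ c : measurable ([set t : k.-tuple T | J c (tnth t i)] `&` @unit_cube R k).
  by apply: measurableI => //; apply: mpre; exact: measurable_itv.
apply: (@le_trans _ _ (leb k (([set t | J a (tnth t i)] `&` @unit_cube R k) `|`
  ([set t | J b (tnth t i)] `&` @unit_cube R k)))).
  apply: le_measure; rewrite ?inE.
  - by apply: measurableI => //; exact: measurable_translation_defect.
  - exact: measurableU.
  - move=> X [+ cX]; rewrite /translation_defect /B /J /= !in_itv/= tnth_tadd => nX.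
    case: (ltP a (tnth X i)) nX; case: (leP (tnth X i) b);
     case: (ltP a (tnth X i + tnth h i)); case: (leP (tnth X i + tnth h i) b) => ? ? ? ? nX;
     try (by exfalso; apply: nX); try lra;
     first [by left; split=> //; apply/andP; split; lra
           |by right; split=> //; apply/andP; split; lra].
apply: le_trans (measureU2 _ _ _) _ => //.
have leJ c : (leb k ([set t | J c (tnth t i)] `&` @unit_cube R k) <= (e / 2)%:E)%E.
  apply: (le_trans (lebesgue_cube_coord_le _ _)); first exact: measurable_itv.
  rewrite lebesgue_measure_itv/= lte_fin; case: ifP => _; rewrite lee_fin; lra.
by rewrite (splitr e) EFinD; apply: leeD; exact: leJ.
Qed.

End TranslateContinuity.
Arguments box {R} k D.

(** * Neighbourhoods of integers on the line *)

Section LineEstimates.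
Context (R : realType).
Local Notation T := (measurableTypeR R).

(* Coprime numerators make fractions with distinct denominators distinct, which
   is what keeps the overlap bound for parallel vectors free of gcd terms. *)
Definition near_coprime (d : nat) (s : R) : set T :=
  [set y | exists2 p : int, coprimez p d & `|y - p%:~R| < s].

Lemma measurable_near_coprime d s : measurable (near_coprime d s).
Proof.
rewrite (_ : near_coprime d s =
    \bigcup_(p in [set p : int | coprimez p d]) ball (p%:~R : R) s).
  by apply: measurable_bigcup_countable => p; exact: measurable_ball.
apply/seteqP; split=> y.
  by move=> [p pd ys]; exists p => //; rewrite /ball /= distrC.
by move=> [p pd ys]; exists p => //; rewrite distrC.
Qed.

Lemma near_coprime1 s y (l : int) : `|y - l%:~R| < s -> near_coprime 1 s y.
Proof. by exists l => //; rewrite /coprimez gcdz1. Qed.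

Lemma near_coprimeW d s : near_coprime d s `<=` near_coprime 1 s.
Proof. by move=> y [p _ /near_coprime1]. Qed.

Lemma near_coprimeD d s y (z : int) : (d%:Z %| z)%Z ->
  near_coprime d s y -> near_coprime d s (y + z%:~R).
Proof.
move=> /dvdzP[k ->] [p pd yp]; exists (p + k * d);
  first by rewrite /coprimez gcdzC addrC gcdzMDl gcdzC.
by rewrite rmorphD/= opprD addrACA subrr addr0.
Qed.

Lemma measurable_affine (A : set T) (z u : R) : measurable A ->
  measurable [set t : T | A (z + u * t)].
Proof.
move=> mA; rewrite -[X in measurable X]setTI.
by apply: (_ : measurable_fun setT (fun t : T => z + u * t : T)) => //;
  apply: measurable_funD => //; apply: measurable_funM.
Qed.

(** For s < 1/2 only [U.+2] integers can be approached, two of them because of the ends of the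
    range, and each gives an interval of length 2 s / U; the total 2 s (1 + 2 / U) is at most 6 s.
    For larger s the bound exceeds 1. *)
Lemma lebesgue_measure_near_int_le (z s : R) (U : nat) : (0 < U)%N -> 0 <= s ->
  (lebesgue_measure ([set t | near_coprime 1 s (z + U%:R * t)%R] `&` `[0%R, 1%R[)
    <= (6 * s)%:E)%E.
Proof.
move=> U0 s0; have U0' : 0 < U%:R :> R by rewrite ltr0n.
have U1' : 1 <= U%:R :> R by rewrite ler1n.
have mS := measurable_affine z U%:R (measurable_near_coprime 1 s).
have [s2|s2] := leP (1/2) s.
  apply: (@le_trans _ _ (lebesgue_measure (`[0%R, 1%R[%classic : set T))).
    by apply: le_measure; rewrite ?inE//; exact: measurableI.
  by rewrite lebesgue_measure_itv/= lte01 oppr0 adde0 lee_fin; lra.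
pose c (j : nat) : R := ((Num.floor z)%:~R + j%:R - z) / U%:R.
pose J j : set T := `]c j - s / U%:R, c j + s / U%:R[%classic.
apply: (@le_trans _ _ (lebesgue_measure (\big[setU/set0]_(j < U.+2) J j))).
  apply: le_measure; rewrite ?inE.
  - exact: measurableI.
  - by apply: bigsetU_measurable => i _; exact: measurable_itv.
  - move=> t [[l _ lt] /=]; rewrite in_itv/= => /andP[t0 t1].
    have := Num.Theory.floor_le z; have := Num.Theory.floorD1_gt z.
    move: lt; rewrite intrD ltr_norml => /andP[l1 l2] f1 f2.
    have Ut0 : 0 <= U%:R * t by rewrite mulr_ge0.
    have Ut1 : U%:R * t < U%:R by rewrite gtr_pMr.
    have fl : (Num.floor z <= l)%R.
      by rewrite -ltzD1 -(ltr_int R) intrD; lra.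
    have lf : (l < Num.floor z + U.+2%:Z)%R.
      by rewrite -(ltr_int R) intrD -pmulrn -[in X in _ < X]addn2 natrD; lra.
    have [j jE] : exists j : nat, l = Num.floor z + j%:Z.
      by exists `|l - Num.floor z|%N; rewrite gez0_abs ?subr_ge0// subrKC.
    have jU : (j < U.+2)%N by move: lf; rewrite jE ltrD2l.
    rewrite -bigcup_mkord; exists j => //.
    rewrite /J /c /= in_itv/= -mulrBl -mulrDl ltr_pdivrMr// ltr_pdivlMr//.
    by move: l1 l2; rewrite jE intrD -pmulrn mulrC => ? ?; apply/andP; split; lra.
have JE j : lebesgue_measure (J j) = (2 * s / U%:R)%:E.
  rewrite /J lebesgue_measure_itv/= lte_fin; case: ifPn => [_|].
    by rewrite -EFinB; congr EFin; field; lra.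
  rewrite -leNgt => h; have sU : 0 <= s / U%:R by rewrite divr_ge0// ltW.
  have sU0 : s / U%:R = 0 by lra.
  by congr EFin; rewrite -mulrA sU0 mulr0.
apply: (le_trans (Boole_inequality _ _)) => [j _|]; first exact: measurable_itv.
rewrite (eq_bigr (fun=> (2 * s / U%:R)%:E)) => [|j _]; last exact: JE.
rewrite sumEFin lee_fin sumr_const card_ord -[X in X <= _]mulr_natr.
rewrite mulrAC ler_pdivrMr// -addn2 natrD.
have : 0 <= s * (U%:R - 1) by rewrite mulr_ge0// subr_ge0.
lra.
Qed.

(* Dividing out gcd(d, e), a point of the set has numerators a, b with
   k := a e' - b d' nonzero (by coprimality), |k| < 2 d' tau, and k determines a
   modulo d'; so the set is covered by at most 4 d' tau sets of measure 6 s / d'. *)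
Lemma lebesgue_measure_near_coprime2_le (y s tau : R) (d e U : nat) :
  (0 < d)%N -> (0 < e)%N -> d != e -> (0 < U)%N -> 0 <= s -> 0 <= tau ->
  (lebesgue_measure ([set t | near_coprime d s (d%:R * (y + U%:R * t))%R /\
       near_coprime e tau (e%:R * (y + U%:R * t))%R] `&` `[0%R, 1%R[)
    <= (24 * (s * tau))%:E)%E.
Proof.
move=> d0 e0 de U0 s0 t0.
(* By symmetry; this gives s e' + tau d' <= 2 d' tau, the bound for the determinant [z] below. *)
wlog se : d e s tau d0 e0 de s0 t0 / s * e%:R <= tau * d%:R.
  move=> H; have [|/ltW] := leP (s * e%:R) (tau * d%:R); first exact: H.
  move=> /(H e d tau s e0 d0); rewrite eq_sym => /(_ de t0 s0).
  rewrite [tau * s]mulrC; apply: le_trans; rewrite le_eqVlt; apply/orP; left; apply/eqP.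
  by congr (lebesgue_measure _); apply/seteqP; split=> t /= [[? ?] ?].
pose g := gcdn d e; pose d' := (d %/ g)%N; pose e' := (e %/ g)%N.
have g0 : (0 < g)%N by rewrite gcdn_gt0 d0.
have dE : d = (d' * g)%N by rewrite divnK// dvdn_gcdl.
have eE : e = (e' * g)%N by rewrite divnK// dvdn_gcdr.
have d'0 : (0 < d')%N by move: d0; rewrite dE muln_gt0 => /andP[].
have e'0 : (0 < e')%N by move: e0; rewrite eE muln_gt0 => /andP[].
have cop : coprimez e' d'.
  rewrite coprimezE !absz_nat coprime_sym /coprime -(eqn_pmul2r g0) muln_gcdl -dE -eE mul1n.
  by [].
(* [x] inverts e' modulo d', so that the numerator [a] is congruent to x z modulo d'. *)
have [x xE] : exists x : int, (d'%:Z %| x * e'%:Z - 1)%Z.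
  have [[u v] /= uv] := coprimezP _ _ cop.
  exists u; apply/dvdzP; exists (- v); rewrite -uv mulNr; ring.
pose K := Num.trunc (2 * (d'%:R * tau)).
have B0 : 0 <= 2 * (d'%:R * tau) by rewrite !mulr_ge0.
(* An enumeration of the nonzero integers of absolute value at most [K]. *)
pose k i : int := if (i < K)%N then Posz i.+1 else Negz (i - K).
(* With a = x k + l d', dividing |d' w - a| < s by d' places w - x k / d' within s / d' of the
   integer l. *)
pose S i : set T := [set t | near_coprime 1 (s / d'%:R)
  (g%:R * y - x%:~R * (k i)%:~R / d'%:R + (g * U)%N%:R * t)] `&` `[0, 1[%classic.
have mS i : measurable (S i).
  by apply: measurableI => //; apply: measurable_affine; exact: measurable_near_coprime.
have d'R : 0 < d'%:R :> R by rewrite ltr0n.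
have e'R : 0 < e'%:R :> R by rewrite ltr0n.
have gR : 0 < g%:R :> R by rewrite ltr0n.
apply: (@le_trans _ _ (lebesgue_measure (\big[setU/set0]_(i < K + K) S i))).
  apply: le_measure; rewrite ?inE.
  - apply: measurableI => //; rewrite (_ : [set _ | _] =
      [set t | near_coprime d s (d%:R * y + (d%:R * U%:R) * t)] `&`
      [set t | near_coprime e tau (e%:R * y + (e%:R * U%:R) * t)]).
      by apply: measurableI; apply: measurable_affine; exact: measurable_near_coprime.
    by apply/seteqP; split=> t; rewrite /= !mulrDr !mulrA.
  - by apply: bigsetU_measurable.
  - move=> t [[[a ad at1] [b be bt1]] t01].
    pose w : R := g%:R * (y + U%:R * t).
    have {}at1 : `|d'%:R * w - a%:~R| < s.
      by move: at1; rewrite {1}dE natrM -mulrA.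
    have {}bt1 : `|e'%:R * w - b%:~R| < tau.
      by move: bt1; rewrite {1}eE natrM -mulrA.
    pose z := a * e'%:Z - b * d'%:Z.
    have zlt : `|z%:~R| < 2 * (d'%:R * tau) :> R.
      have -> : z%:~R = (e'%:R * w - b%:~R) * d'%:R - (d'%:R * w - a%:~R) * e'%:R :> R.
        rewrite /z rmorphB/= !rmorphM/= -!pmulrn; ring.
      apply: (le_lt_trans (ler_normB _ _)); rewrite !normrM !normr_nat.
      have : `|e'%:R * w - b%:~R| * d'%:R < tau * d'%:R by rewrite ltr_pM2r.
      have : `|d'%:R * w - a%:~R| * e'%:R < s * e'%:R by rewrite ltr_pM2r.
      have : s * e'%:R <= tau * d'%:R.
        move: se; rewrite {1}dE {1}eE !natrM !mulrA ler_pM2r//.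
      lra.
    have z0 : z != 0.
      apply/eqP => /eqP; rewrite subr_eq0 => /eqP zab.
      have {}zab : a * e = b * d by rewrite dE eE !PoszM !mulrA zab.
      have ded : (d %| e)%N.
        rewrite -[(_ %| _)%N]/(d%:Z %| e%:Z)%Z -(@Gauss_dvdzr _ a);
          last by rewrite coprimez_sym.
        by rewrite zab dvdz_mull.
      have edd : (e %| d)%N.
        rewrite -[(_ %| _)%N]/(e%:Z %| d%:Z)%Z -(@Gauss_dvdzr _ b);
          last by rewrite coprimez_sym.
        by rewrite -zab dvdz_mull.
      by move: de; rewrite eqn_dvd ded edd.
    have [l lE] : exists l, a = x * z + l * d'%:Z.
      case/dvdzP: xE => v vE; exists (- a * v + x * b).
      have -> : x * z = a * (x * e'%:Z - 1) + a - x * b * d'%:Z by rewrite /z; ring.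
      by rewrite vE; ring.
    clearbody z.
    have zK : (`|z| <= K)%N.
      by rewrite truncn_ge_nat// natr_absz intr_norm ltW.
    have [i iK ki] : exists2 i, (i < K + K)%N & k i = z.
      case: (z) z0 zK => [[|n]|n] // _; rewrite /= ?NegzE => nK.
        by exists n; rewrite ?ltn_addr// /k nK.
      exists (K + n)%N; first by rewrite ltn_add2l.
      by rewrite /k ltnNge leq_addr/= addKn.
    rewrite -bigcup_mkord; exists i => //; split=> //=; apply: (@near_coprime1 _ _ l).
    rewrite ki ltr_pdivlMr// -[X in _ * X]gtr0_norm// -normrM.
    have -> : (g%:R * y - x%:~R * z%:~R / d'%:R + (g * U)%N%:R * t - l%:~R) * d'%:R =
        d'%:R * w - a%:~R :> R.
      have -> : a%:~R = x%:~R * z%:~R + l%:~R * d'%:R :> R by rewrite lE rmorphD/= !rmorphM.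
      by rewrite /w natrM; field; lra.
    exact: at1.
apply: (le_trans (Boole_inequality _ _)) => //.
apply: (@le_trans _ _ (\sum_(i < K + K) (6 * (s / d'%:R))%:E)%E).
  apply: lee_sum => i _; apply: lebesgue_measure_near_int_le; last exact: divr_ge0.
  by rewrite muln_gt0 g0.
rewrite sumEFin lee_fin sumr_const card_ord -[leLHS]mulr_natr natrD.
have KB : K%:R <= 2 * (d'%:R * tau) by rewrite truncn_le.
have sd : 0 <= s / d'%:R by rewrite divr_ge0.
have := ler_wpM2l sd KB; rewrite (_ : s / d'%:R * (2 * (d'%:R * tau)) = 2 * (s * tau)).
  lra.
by field; lra.
Qed.

End LineEstimates.

(** * Integers coprime to a light denominator in short intervals *)

Section CoprimeCount.
Context (R : realType).
Local Notation T := (measurableTypeR R).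

(** Two counted indices in the same block of length p are congruent modulo p, hence equal. *)
Lemma count_dvd_interval (a : int) (p L : nat) : (0 < p)%N ->
  (#|[pred j : 'I_L | (p%:Z %| (a + (j : nat)%:Z)%R)%Z]| <= (L %/ p).+1)%N.
Proof.
move=> p0; pose q (j : 'I_L) : 'I_(L %/ p).+1 := inord (j %/ p).
rewrite -[leqRHS]card_ord -(@card_in_image _ _ q); first exact: max_card.
move=> i j /[!inE] pi pj /(congr1 val); rewrite /= /q !inordK ?ltnS ?leq_div2r 1?ltnW// => ij.
apply: val_inj => /=; rewrite (divn_eq i p) (divn_eq j p) ij; congr addn.
have : (p%:Z %| (i : nat)%:Z - (j : nat)%:Z)%Z.
  rewrite (_ : _ - _ = (a + (i : nat)%:Z) - (a + (j : nat)%:Z)); last by ring.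
  by apply: rpredB.
rewrite -eqz_mod_dvd => /eqP; rewrite !modz_nat => -[].
by [].
Qed.

(* 7/8 lies between the bound 3/4 for the average of the sum over d <= N and 1;
   below 1, a union bound over p leaves a positive proportion of residues. *)
Definition light (d : nat) := \sum_(p <- primes d) (p%:R^-1 : R) <= 7%:R / 8%:R.

(** Each prime divisor p of d removes at most L / p + 1 indices, and lightness bounds the sum of the
    L / p by 7 L / 8. *)
Lemma count_coprime_interval (a : int) (d L : nat) : (0 < d)%N -> light d ->
  (L%:R / 8%:R - (size (primes d))%:R <= #|[pred j : 'I_L | coprimez (a + (j : nat)%:Z) d]|%:R :> R).
Proof.
move=> d0 ld.
set C := [pred j | _].
have LE : (L = #|C| + #|[predC C]|)%N by rewrite cardC card_ord.
have : #|[predC C]|%:R <= \sum_(p <- primes d) (L%:R * p%:R^-1 + 1) :> R.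
  apply: (@le_trans _ _ (\sum_(p <- primes d) #|[pred j : 'I_L | (p%:Z %| (a + (j : nat)%:Z)%R)%Z]|)%N%:R).
    rewrite ler_nat -sum1_card.
    under [leqRHS]eq_bigr do rewrite -sum1_card big_mkcond.
    rewrite exchange_big/= big_mkcond/=; apply: leq_sum => j _.
    case: ifPn => // /[!inE] nc.
    have [p pd pj] : exists2 p, p \in primes d & (p%:Z %| (a + (j : nat)%:Z)%R)%Z.
      have gd0 : (0 < gcdn `|(a + (j : nat)%:Z)%R|%N d)%N by rewrite gcdn_gt0 d0 orbT.
      exists (pdiv (gcdn `|(a + (j : nat)%:Z)%R|%N d)).
        rewrite mem_primes d0 (dvdn_trans (pdiv_dvd _) (dvdn_gcdr _ _)) !andbT.
        apply: pdiv_prime; rewrite ltn_neqAle gd0 andbT eq_sym.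
        by move: nc; rewrite coprimezE.
      by rewrite dvdzE absz_nat (dvdn_trans (pdiv_dvd _) (dvdn_gcdl _ _)).
    by rewrite (big_rem p)//= inE pj.
  rewrite natr_sum big_seq [leRHS]big_seq; apply: ler_sum => p.
  rewrite mem_primes => /and3P[pp _ _].
  have p0 := prime_gt0 pp; apply: (@le_trans _ _ (L %/ p).+1%:R).
    by rewrite ler_nat count_dvd_interval.
  by rewrite -natr1 lerD2r ler_pdivlMr ?ltr0n// -natrM ler_nat leq_trunc_div.
have szE : \sum_(p <- primes d) (1 : R) = (size (primes d))%:R by rewrite -sum1_size natr_sum.
rewrite big_split/= -mulr_sumr szE => H.
have : L%:R * \sum_(p <- primes d) (p%:R^-1 : R) <= L%:R * (7%:R / 8%:R) by rewrite ler_wpM2l.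
by have := congr1 (fun n => n%:R : R) LE; rewrite natrD; lra.
Qed.

Lemma expn2_size_primes d : (0 < d)%N -> (2 ^ size (primes d) <= d)%N.
Proof.
move=> d0; rewrite [leqRHS]prod_prime_decomp// prime_decompE big_map.
rewrite -[in leqLHS]sum1_size expn_sum big_seq [leqRHS]big_seq.
apply: leq_prod => p; rewrite mem_primes => /and3P[pp _ pd] /=.
apply: leq_trans (prime_gt1 pp) _; rewrite -[leqLHS]expn1.
apply: leq_pexp2l; first exact: prime_gt0.
by rewrite logn_gt0 mem_primes pp d0.
Qed.

Lemma sqrn_le_expn2 w : (w ^ 2 <= 2 * 2 ^ w)%N.
Proof.
case: w => [|[|[|w]]] //; elim: w => // w IH.
rewrite [(2 ^ w.+4)%N]expnS; move: (2 ^ w.+3)%N IH => X.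
by rewrite -!mulnn; nia.
Qed.

(** For w the number of prime divisors, w^2 <= 2 2^w <= 2 d <= 2 N, so w is O(sqrt N). *)
Lemma size_primes_le (d N : nat) (r : R) : (0 < d)%N -> (d <= N)%N -> 0 < r ->
  2 / r ^+ 2 <= N%:R -> (size (primes d))%:R <= r * N%:R.
Proof.
move=> d0 dN r0 Nr; rewrite leNgt; apply/negP => lt.
have w2 : (size (primes d))%:R ^+ 2 <= 2 * N%:R :> R.
  rewrite -natrX -natrM ler_nat; apply: leq_trans (sqrn_le_expn2 _) _.
  by rewrite leq_mul2l (leq_trans (expn2_size_primes d0)).
have N0 : 0 < N%:R :> R by rewrite ltr0n (leq_trans d0).
have : (r * N%:R) ^+ 2 < 2 * N%:R.
  apply: lt_le_trans w2; have rN0 : 0 <= r * N%:R by rewrite mulr_ge0 ?ltW.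
  by rewrite !expr2; apply: ltr_pM.
move: Nr; rewrite ler_pdivrMr ?exprn_gt0// => Nr.
rewrite exprMn; have : 2 * N%:R <= N%:R * r ^+ 2 * N%:R by rewrite ler_pM2r.
rewrite [(N%:R : R) ^+ 2]expr2 mulrAC -mulrA mulrC; lra.
Qed.

(** At least delta N / 16 of the integers passed by z + N t are coprime to d, and to the right of
    each lies an interval of parameters of length s / N; these are disjoint as s <= 1/2. The
    constant 2048 = 2 32^2 makes the number of primes of d at most delta N / 32. *)
Lemma lebesgue_measure_near_coprime_ge (z s delta : R) (d N : nat) :
  (0 < d)%N -> light d -> (d <= N)%N -> 0 < delta <= 1 -> 0 <= s <= 1 / 2 ->
  2048 / delta ^+ 2 <= N%:R ->
  ((s * delta / 16)%:E <= lebesgue_measure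
     ([set t | near_coprime d s (z + N%:R * t)%R] `&` `[0%R, delta[ : set T))%E.
Proof.
move=> d0 ld dN /andP[de0 de1] /andP[s0 s1] Nb.
have N0n : (0 < N)%N by exact: leq_trans dN.
have N0 : 0 < N%:R :> R by rewrite ltr0n.
have wN : (size (primes d))%:R <= delta / 32 * N%:R.
  apply: size_primes_le => //; first by rewrite divr_gt0.
  by apply: le_trans Nb; rewrite le_eqVlt; apply/orP; left; apply/eqP; field; lra.
have Nd : 2048 <= delta * N%:R.
  have d20 : 0 < delta ^+ 2 by rewrite exprn_gt0.
  move: Nb; rewrite ler_pdivrMr// => Nb; apply: (le_trans Nb).
  by rewrite mulrC ler_pM2r// expr2 ger_pMr.
(* The predecessor leaves room for rounding [z] up and for the neighbourhood of the last integer. *)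
pose L := (Num.trunc (delta * N%:R)).-1.
have dN0 : 0 <= delta * N%:R by rewrite mulr_ge0 ?ltW.
have L1 : delta * N%:R - 2 <= L%:R /\ L%:R + 1 <= delta * N%:R.
  have := truncn_itv dN0; rewrite /L.
  have : (0 < Num.trunc (delta * N%:R))%N by rewrite truncn_gt0; lra.
  by case: (Num.trunc _) => [//|l] _; rewrite -!natr1/= => /andP[]; lra.
have [L2 L3] := L1.
pose a := Num.ceil z.
have [az1 az2] := andP (Num.Theory.ceil_itv z); rewrite -/a intrB/= in az1 az2.
pose C := [pred j : 'I_L | coprimez (a + (j : nat)%:Z) d].
have cC : delta * N%:R / 16 <= #|C|%:R.
  by have := count_coprime_interval a L d0 ld; rewrite -/C; lra.
pose c (j : 'I_L) : R := (a%:~R + (j : nat)%:R - z) / N%:R.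
pose J j : set T := `[c j, c j + s / N%:R[%classic.
have sN : 0 <= s / N%:R by rewrite divr_ge0// ltW.
apply: (@le_trans _ _ (lebesgue_measure (\big[setU/set0]_(j < L | C j) J j))).
  rewrite (_ : lebesgue_measure _ = \sum_(j < L | C j) lebesgue_measure (J j))%E; last first.
    apply: measure_bigsetU_ord_cond => [i _|]; first exact: measurable_itv.
    apply/trivIsetP => i j _ _ ij; apply/seteqP; split=> t //=.
    rewrite /J /c /= !in_itv/= => -[/andP[t1 t2] /andP[t3 t4]].
    case/eqP: ij; apply: val_inj; apply/eqP; rewrite eqn_leq.
    have lt1 (i' j' : nat) : (a%:~R + i'%:R - z) / N%:R < (a%:~R + j'%:R - z) / N%:R + s / N%:R -> (i' <= j')%N.
      rewrite -mulrDl ltr_pM2r ?invr_gt0// => h.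
      by rewrite -ltnS -(ltr_nat R) -natr1; lra.
    by apply/andP; split; apply: lt1; [exact: le_lt_trans t4|exact: le_lt_trans t2].
  rewrite (eq_bigr (fun=> (s / N%:R)%:E)) => [|j _]; last first.
    rewrite /J lebesgue_measure_itv/= lte_fin ltrDl.
    have [sN0|sN0] := ltP 0 (s / N%:R).
      by rewrite -EFinB; congr EFin; ring.
    by congr EFin; apply/eqP; rewrite eq_le sN sN0.
  rewrite sumEFin lee_fin sumr_const -[leRHS]mulr_natr.
  have := ler_wpM2l sN cC; apply: le_trans; rewrite le_eqVlt; apply/orP; left.
  by apply/eqP; field; lra.
apply: le_measure; rewrite ?inE.
- by apply: bigsetU_measurable => i _; exact: measurable_itv.
- by apply: measurableI => //; apply: measurable_affine; exact: measurable_near_coprime.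
- apply: (big_ind (fun A : set T => A `<=` _)) => [//|A B ? ?|j Cj t].
    by rewrite subUset.
  have jL : (j : nat)%:R + 1 <= L%:R :> R by rewrite natr1 ler_nat.
  have j0 : 0 <= (j : nat)%:R :> R by [].
  rewrite /J /c /= !in_itv/= -mulrDl ler_pdivrMr// ltr_pdivlMr// => /andP[t1 t2]; split.
    exists (a + (j : nat)%:Z) => //.
    by rewrite ltr_norml rmorphD/= -pmulrn; apply/andP; split; lra.
  apply/andP; split.
    by rewrite -(ler_pM2r N0) mul0r; lra.
  by rewrite -(ltr_pM2r N0); lra.
Qed.

End CoprimeCount.

(** * Approximation sets of linear forms *)

Section LinearFormSets.
Context (R : realType) (n m : nat).
Local Notation T := (measurableTypeR R).
Local Notation leb := (lebesgue_tuple R).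
Local Notation Omega := ((n * m).-tuple T).
Local Notation cube := (@unit_cube R (n * m)).
Implicit Types (q r : 'rV[nat]_n) (X : Omega) (t : m.-tuple T) (w : 'I_n -> R).

Definition linear_form q X (j : 'I_m) : R :=
  \sum_i (q ord0 i)%:R * tnth X (mxvec_index i j).

Definition rank1_tuple w t : Omega :=
  [tuple mxvec (\matrix_(i < n, j < m) (w i * tnth t j)) ord0 l | l < n * m].

Lemma tnth_rank1_tuple w t i j : tnth (rank1_tuple w t) (mxvec_index i j) = w i * tnth t j.
Proof. by rewrite tnth_mktuple mxvecE mxE. Qed.

Lemma measurable_rank1_tuple w : measurable_fun [set: m.-tuple T] (rank1_tuple w).
Proof.
apply/measurable_fun_tnthP => l; case/mxvec_indexP: l => i j.
rewrite (_ : _ \o _ = fun t => w i * (tnth t j : T)); last first.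
  by apply/funext => t /=; rewrite tnth_rank1_tuple.
by apply: measurable_funM => //; exact: measurable_tnth.
Qed.

(** Each coordinate of [t] moves just one entry of qX, at a speed independent of [X]; this turns
    averages over [t] into products of m one-dimensional measures. *)
Lemma linear_form_tadd q X w t j :
  linear_form q (tadd X (rank1_tuple w t)) j =
  linear_form q X j + (\sum_i (q ord0 i)%:R * w i) * tnth t j.
Proof.
rewrite /linear_form mulr_suml -big_split/=; apply: eq_bigr => i _.
by rewrite tnth_tadd tnth_rank1_tuple mulrDr mulrA.
Qed.

Lemma measurable_linear_form q j : measurable_fun [set: Omega] (fun X => linear_form q X j : T).
Proof.
apply: measurable_sum => i; apply: measurable_funM => //; exact: measurable_tnth.
Qed.

(** d = 1 allows all numerators, as the convergence part requires; the divergence part takes the gcd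
    of [q]. *)
Definition coprime_approx_set d q (s : R) : set Omega :=
  [set X | forall j, near_coprime d s (linear_form q X j)].

Definition approx_set q s := coprime_approx_set (gcd_row q) q s.

Lemma measurable_coprime_approx_set d q s : measurable (coprime_approx_set d q s).
Proof.
rewrite (_ : coprime_approx_set d q s = \bigcap_(j in [set: 'I_m])
  ((fun X => linear_form q X j : T) @^-1` near_coprime d s)).
  apply: fin_bigcap_measurable => // j _; rewrite -[X in measurable X]setTI.
  by apply: measurable_linear_form => //; exact: measurable_near_coprime.
by apply/seteqP; split=> X /=; [move=> h j _; exact: h|move=> h j; exact: h].
Qed.

Lemma measurable_approx_set q s : measurable (approx_set q s).
Proof. exact: measurable_coprime_approx_set. Qed.

Lemma gcd_row_dvd q i : (gcd_row q %| q ord0 i)%N.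
Proof. by rewrite /gcd_row (bigD1 i)//= dvdn_gcdl. Qed.

(** An integer change of [X] changes the entries of qX by multiples of d, which preserves
    coprimality of the numerators. *)
Lemma periodic_coprime_approx_set d q s : (forall i, d %| q ord0 i)%N ->
  periodic (coprime_approx_set d q s).
Proof.
move=> dq X Y XY AX j.
pose z := \sum_i (q ord0 i)%:Z * Num.floor (tnth Y (mxvec_index i j) - tnth X (mxvec_index i j)).
have -> : linear_form q Y j = linear_form q X j + z%:~R.
  rewrite /linear_form /z rmorph_sum -big_split/=; apply: eq_bigr => i _.
  rewrite rmorphM/= -pmulrn floorK ?mulrBr ?subrKC//.
  by have := XY (mxvec_index i j); rewrite -rpredN opprB.
apply: near_coprimeD; last exact: AX.
apply: rpred_sum => i _; apply: dvdz_mulr.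
by rewrite dvdzE !absz_nat.
Qed.

Lemma periodic_approx_set q s : periodic (approx_set q s).
Proof. exact: periodic_coprime_approx_set (gcd_row_dvd q). Qed.

Lemma periodicI k (E F : set (k.-tuple T)) : periodic E -> periodic F -> periodic (E `&` F).
Proof. by move=> pE pF X Y XY [EX FX]; split; [exact: pE EX|exact: pF FX]. Qed.

Lemma measurable_translates w (F E : set Omega) (B : set (m.-tuple T)) :
  measurable F -> measurable E -> measurable B ->
  measurable [set p : Omega * m.-tuple T |
    (F p.1 /\ cube p.1) /\ (E (tadd p.1 (rank1_tuple w p.2)) /\ B p.2)].
Proof.
move=> mF mE mB.
have mc := @measurable_unit_cube R (n * m).
have mfst (C : set Omega) : measurable C -> measurable [set p : Omega * m.-tuple T | C p.1].
  by move=> mC; rewrite -[X in measurable X]setTI; exact: measurable_fst.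
apply: measurableI; first by apply: measurableI; exact: mfst.
apply: measurableI; rewrite -[X in measurable X]setTI; last exact: measurable_snd.
apply: (measurable_tadd measurable_fst (measurableT_comp (measurable_rank1_tuple w) measurable_snd)) => //.
Qed.

Lemma lebesgue_unit_cube k : leb k (@unit_cube R k) = 1%E.
Proof. by have := @lebesgue_tuple_box_itv R k 1 ler01; rewrite expr1n. Qed.

Lemma lee_prod (I : Type) (s : seq I) (f g : I -> \bar R) :
  (forall i, 0 <= f i <= g i)%E -> (\prod_(i <- s) f i <= \prod_(i <- s) g i)%E.
Proof.
move=> fg; suff /andP[] : (0 <= \prod_(i <- s) f i <= \prod_(i <- s) g i)%E by [].
elim/big_ind2: _ => [|a b c d /andP[b0 ba] /andP[d0 dc]|//]; first by rewrite lee01 lexx.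
by rewrite mule_ge0//= lee_pmul.
Qed.

(* By periodicity, the measure of the intersection is unchanged if E is replaced
   by its translate along rank1_tuple w t; averaging over t and exchanging the
   integrals, it suffices to bound the proportion of good t for each fixed X. *)
Lemma lebesgue_cubeI_le w (F E : set Omega) (c : R) : 0 <= c ->
  measurable F -> measurable E -> periodic F -> periodic E ->
  (forall X t, F (tadd X (rank1_tuple w t)) <-> F X) ->
  (forall X, exists B : 'I_m -> set T, [/\ forall j, measurable (B j),
    forall j, (lebesgue_measure (B j `&` `[0%R, 1%R[) <= c%:E)%E &
    forall t, E (tadd X (rank1_tuple w t)) -> forall j, B j (tnth t j)]) ->
  (leb (n * m) ((F `&` E) `&` cube) <= (c ^+ m)%:E * leb (n * m) (F `&` cube))%E.
Proof.
move=> c0 mF mE pF pE Fw H.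
have mc := @measurable_unit_cube R (n * m).
have mcm := @measurable_unit_cube R m.
have mI := measurable_translates w mF mE mcm.
have := @tonelli_set_le _ _ _ _ _ (leb (n * m)) (leb m) _ (F `&` cube) (c ^+ m)%:E mI.
move=> /(_ (measurableI _ _ mF mc)); set L := (integral _ _ _) => Lle.
have LE : L = leb (n * m) ((F `&` E) `&` cube).
  rewrite /L (@ge0_integral_support _ _ _ _ (@unit_cube R m)); last first.
    move=> t nt; rewrite (_ : [set _ | _] = set0) ?measure0//.
    by apply/seteqP; split=> X //= -[_ [_]].
  rewrite (eq_integral (cst (leb (n * m) ((F `&` E) `&` cube)))).
    rewrite integral_cst// -[RHS]mule1; congr (_ * _)%E; exact: lebesgue_unit_cube.
  move=> t /set_mem ct /=.
  rewrite -[RHS](lebesgue_cube_tadd (rank1_tuple w t)); first last.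
  - exact: periodicI.
  - exact: measurableI.
  congr (leb _ _); apply/seteqP; split=> X /=.
    by move=> [[FX cX] [EX _]]; split=> //; split=> //; apply/Fw.
  by move=> [[/Fw FX EX] cX].
rewrite -LE; apply: Lle.
- by move=> X t /= [].
- by rewrite lee_fin exprn_ge0.
move=> X; have [B [mB Bc HB]] := H X.
apply: (@le_trans _ _ (leb m [set t | forall j, (B j `&` `[0%R, 1%R[%classic) (tnth t j)])).
  apply: le_measure; rewrite ?inE.
  - rewrite -[X in measurable X]setTI.
    exact: (pair1_measurable X measurableT mI).
  - by apply: (@measurable_box R m (fun j => B j `&` `[0%R, 1%R[%classic)) => j;
    exact: measurableI.
  - by move=> t /= [_ [/HB Et ct]] j; split; [exact: Et|exact: ct].
rewrite (@lebesgue_tuple_box R m (fun j => B j `&` `[0%R, 1%R[%classic)); last by move=> j;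
  exact: measurableI.
rewrite -[m in _ ^+ m]card_ord -prodr_const -prodEFin.
by apply: lee_prod => j; apply/andP; split; [exact: measure_ge0|exact: Bc].
Qed.

Definition unit_row (i0 : 'I_n) : 'I_n -> R := fun i => (i == i0)%:R.

Lemma sum_unit_row q i0 : \sum_i (q ord0 i)%:R * unit_row i0 i = (q ord0 i0)%:R :> R.
Proof.
rewrite (bigD1 i0)//= /unit_row eqxx mulr1 big1 ?addr0// => i /negPf ->.
by rewrite mulr0.
Qed.

(** Along [w] the set [F] is constant while the entries of qX move at integer speed [D], so the
    approximation condition acts as if independent of [F], up to the constant 6. *)
Lemma approx_setI_le (F : set Omega) w d q s D : (forall i, d %| q ord0 i)%N -> (0 < D)%N ->
  0 <= s ->
  measurable F -> periodic F -> (forall X t, F (tadd X (rank1_tuple w t)) <-> F X) ->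
  \sum_i (q ord0 i)%:R * w i = D%:R :> R ->
  (leb (n * m) ((F `&` coprime_approx_set d q s) `&` cube)
     <= ((6 * s) ^+ m)%:E * leb (n * m) (F `&` cube))%E.
Proof.
move=> dq D0 s0 mF pF Fw qw; apply: (lebesgue_cubeI_le (w := w)) => //.
- by rewrite mulr_ge0.
- exact: measurable_coprime_approx_set.
- exact: periodic_coprime_approx_set.
move=> X; exists (fun j => [set t | near_coprime 1 s (linear_form q X j + D%:R * t)]).
split=> [j|j|t At j].
- by apply: measurable_affine; exact: measurable_near_coprime.
- exact: lebesgue_measure_near_int_le.
- by have := At j; rewrite linear_form_tadd qw => /near_coprimeW.
Qed.

Lemma approx_set_le d q s i0 : (forall i, d %| q ord0 i)%N -> (0 < q ord0 i0)%N -> 0 <= s ->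
  (leb (n * m) (coprime_approx_set d q s `&` cube) <= ((6 * s) ^+ m)%:E)%E.
Proof.
move=> dq q0 s0; have := @approx_setI_le setT (unit_row i0) d q s _ dq q0 s0 measurableT.
rewrite !setTI lebesgue_unit_cube mule1; by apply=> //; exact: sum_unit_row.
Qed.

Lemma approx_set_nonparallel q r s tau i j : 0 <= s -> 0 <= tau ->
  (q ord0 j * r ord0 i < q ord0 i * r ord0 j)%N ->
  (leb (n * m) ((approx_set q s `&` approx_set r tau) `&` cube) <=
    ((36 * (s * tau)) ^+ m)%:E)%E.
Proof.
move=> s0 t0 qr; have qi : (0 < q ord0 i)%N.
  by case: (q ord0 i) qr => //; rewrite mul0n ltn0.
(* w is orthogonal to q but not to r *)
pose w l : R := (q ord0 i)%:R * unit_row j l - (q ord0 j)%:R * unit_row i l.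
have sumw q' : \sum_l (q' ord0 l)%:R * w l =
    (q ord0 i)%:R * (q' ord0 j)%:R - (q ord0 j)%:R * (q' ord0 i)%:R :> R.
  rewrite -(sum_unit_row q' j) -(sum_unit_row q' i) !mulr_sumr -sumrB.
  by apply: eq_bigr => l _; rewrite /w; ring.
apply: (@le_trans _ _ (((6 * tau) ^+ m)%:E * leb (n * m) (approx_set q s `&` cube))%E).
  apply: (@approx_setI_le _ w (gcd_row r) r tau (q ord0 i * r ord0 j - q ord0 j * r ord0 i)%N) => //.
  - exact: gcd_row_dvd.
  - by rewrite subn_gt0.
  - exact: measurable_approx_set.
  - exact: periodic_approx_set.
  - move=> X t; suff E l : linear_form q (tadd X (rank1_tuple w t)) l = linear_form q X l.
      by split=> + l => /(_ l); rewrite E.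
    by rewrite linear_form_tadd sumw [X in X - _]mulrC subrr mul0r addr0.
  - by rewrite sumw natrB ?natrM// ltnW.
have -> : ((36 * (s * tau)) ^+ m)%:E = (((6 * tau) ^+ m)%:E * ((6 * s) ^+ m)%:E)%E.
  by rewrite -EFinM -exprMn; congr (_ ^+ _)%:E; ring.
apply: lee_wpmul2l; first by rewrite lee_fin exprn_ge0// mulr_ge0.
exact: (approx_set_le (gcd_row_dvd q) qi).
Qed.

(** Here q = d v and r = e v for a common integer vector v, and d differs from e because q differs
    from r. Both conditions then concern vX, and the overlap bound on the line applies to each
    entry. *)
Lemma approx_set_parallel q r s tau : 0 <= s -> 0 <= tau ->
  (0 < gcd_row q)%N -> (0 < gcd_row r)%N -> q != r ->
  (forall i j, q ord0 i * r ord0 j = q ord0 j * r ord0 i)%N ->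
  (leb (n * m) ((approx_set q s `&` approx_set r tau) `&` cube) <=
    ((24 * (s * tau)) ^+ m)%:E)%E.
Proof.
move=> s0 t0 d0 e0 qr par; set d := gcd_row q in d0 *; set e := gcd_row r in e0 *.
have qd i : q ord0 i = (d * (q ord0 i %/ d))%N by rewrite mulnC divnK// gcd_row_dvd.
(* Both sides are the gcd over j of q_i r_j = r_i q_j. *)
have qe i : (q ord0 i * e = r ord0 i * d)%N.
  rewrite /e /d /gcd_row (big_morph _ (muln_gcdr (q ord0 i)) (muln0 _)).
  rewrite (big_morph _ (muln_gcdr (r ord0 i)) (muln0 _)).
  by apply: eq_bigr => j _; rewrite par mulnC.
have rE i : r ord0 i = (e * (q ord0 i %/ d))%N.
  apply/eqP; rewrite -(eqn_pmul2r d0) -qe {1}(qd i); apply/eqP; ring.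
have de : d != e.
  by apply: contra qr => /eqP de; apply/eqP/rowP => i; rewrite qd rE de.
have [i0 qi0] : exists i0, (0 < q ord0 i0 %/ d)%N.
  apply: contrapT => nq; move: d0; rewrite /d /gcd_row big1// => i _.
  apply/eqP; rewrite qd muln_eq0; apply/orP; right.
  by rewrite -leqn0 leqNgt; apply/negP => h; apply: nq; exists i.
have := @lebesgue_cubeI_le (unit_row i0) setT (approx_set q s `&` approx_set r tau)
  (24 * (s * tau)).
rewrite !setTI lebesgue_unit_cube mule1; apply => //.
- by rewrite !mulr_ge0.
- by apply: measurableI; exact: measurable_approx_set.
- by apply: periodicI; exact: periodic_approx_set.
move=> X; pose y j := \sum_i (q ord0 i %/ d)%:R * tnth X (mxvec_index i j) : R.
have lfE q' c j : (forall i, q' ord0 i = c * (q ord0 i %/ d))%N ->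
    linear_form q' X j = c%:R * y j.
  move=> qc; rewrite /linear_form /y mulr_sumr; apply: eq_bigr => i _.
  by rewrite qc natrM mulrA.
exists (fun j => [set t | near_coprime d s (d%:R * (y j + (q ord0 i0 %/ d)%:R * t)) /\
       near_coprime e tau (e%:R * (y j + (q ord0 i0 %/ d)%:R * t))]).
split=> [j|j|t [At Bt] j].
- rewrite (_ : [set _ | _] =
      [set t | near_coprime d s (d%:R * y j + (d%:R * (q ord0 i0 %/ d)%:R) * t)] `&`
      [set t | near_coprime e tau (e%:R * y j + (e%:R * (q ord0 i0 %/ d)%:R) * t)]).
    by apply: measurableI; apply: measurable_affine; exact: measurable_near_coprime.
  by apply/seteqP; split=> t; rewrite /= !mulrDr !mulrA.
- exact: lebesgue_measure_near_coprime2_le.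
- have qdR : (q ord0 i0)%:R = d%:R * (q ord0 i0 %/ d)%:R :> R by rewrite -natrM -qd.
  have rER : (r ord0 i0)%:R = e%:R * (q ord0 i0 %/ d)%:R :> R by rewrite -natrM -rE.
  have := At j; have := Bt j; rewrite !linear_form_tadd !sum_unit_row.
  rewrite (lfE q d j qd) (lfE r e j rE) qdR rER -!mulrA -!mulrDr.
  by split.
Qed.

(** Moving row [i0] gives every entry of qX the speed [q ord0 i0], a positive multiple of the gcd
    and so at least the gcd, as the bound on the line demands. *)
Lemma approx_set_translates_ge q s i0 (delta : R) X :
  (0 < q ord0 i0)%N -> light R (gcd_row q) -> 0 < delta <= 1 -> 0 <= s <= 1 / 2 ->
  2048 / delta ^+ 2 <= (q ord0 i0)%:R ->
  (((s * delta / 16) ^+ m)%:E <= leb m ([set t |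
     approx_set q s (tadd X (rank1_tuple (unit_row i0) t))] `&` box m `[0%R, delta[%classic))%E.
Proof.
move=> q0 lq de s01 qN.
have d0 : (0 < gcd_row q)%N.
  by rewrite lt0n; apply/eqP => d0; have := gcd_row_dvd q i0; rewrite d0 dvd0n;
    case: (q _ _) q0.
rewrite (_ : _ `&` _ = [set t | forall j, ([set t | near_coprime (gcd_row q) s
    (linear_form q X j + (q ord0 i0)%:R * t)] `&` `[0%R, delta[%classic) (tnth t j)]).
  rewrite (@lebesgue_tuple_box R m (fun j => [set t | near_coprime (gcd_row q) s
    (linear_form q X j + (q ord0 i0)%:R * t)] `&` `[0%R, delta[%classic)); last first.
    move=> j; apply: measurableI => //.
    by apply: measurable_affine; exact: measurable_near_coprime.
  rewrite -[m in _ ^+ m]card_ord -prodr_const -prodEFin.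
  have c0 : 0 <= s * delta / 16.
    by case/andP: s01 => s0 _; case/andP: de => de0 _; rewrite divr_ge0// mulr_ge0// ltW.
  apply: lee_prod => j; rewrite lee_fin c0/=.
  by apply: lebesgue_measure_near_coprime_ge => //; exact: dvdn_leq (gcd_row_dvd q i0).
apply/seteqP; split=> t /=.
  by move=> [At dt] j; have := At j; rewrite linear_form_tadd sum_unit_row; split=> //;
    exact: dt.
by move=> H; split=> j; have [] := H j; rewrite // linear_form_tadd sum_unit_row.
Qed.

End LinearFormSets.

(** * Divergence over light denominators *)

Section Divergence.
Context (R : realType).

Lemma sum_inv_sqr_le (N : nat) : \sum_(2 <= p < N.+1) (p%:R ^- 2 : R) <= 3%:R / 4%:R.
Proof.
have [N1|N2] := leqP N 1; first by rewrite big_geq// divr_ge0.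
(* This form telescopes: it is an equality at N = 2, and 1 / (N + 1)^2 <= 1 / N - 1 / (N + 1). *)
suff : \sum_(2 <= p < N.+1) (p%:R ^- 2 : R) <= 3%:R / 4%:R - N%:R^-1.
  by move=> H; apply: (le_trans H); rewrite gerBl invr_ge0.
elim: N N2 => // N IH; rewrite ltnS leq_eqVlt => /predU1P[<-|N1].
  by rewrite big_nat1; lra.
rewrite big_nat_recr/=; last by rewrite ltnS ltnW.
apply: (le_trans (lerD (IH N1) (lexx _))).
have N0 : 0 < N%:R :> R by rewrite ltr0n ltnW.
rewrite -natr1 -lerBrDl -subr_ge0.
rewrite (_ : _ - _ = (N%:R * (N%:R + 1) ^+ 2)^-1); last by field; lra.
by rewrite invr_ge0 mulr_ge0 ?ltW// exprn_gt0// addr_gt0.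
Qed.

Let sum_inv_primes (d : nat) : R := \sum_(p <- primes d) p%:R^-1.

(** Admitting all p >= 2 in place of primes and exchanging the sums gives floor(N / p) / p <= N /
    p^2 for each p. *)
Lemma sum_inv_primes_avg (N : nat) :
  \sum_(1 <= d < N.+1) sum_inv_primes d <= 3%:R / 4%:R * N%:R.
Proof.
apply: (@le_trans _ _ (\sum_(1 <= d < N.+1) \sum_(2 <= p < N.+1) (p %| d)%:R * p%:R^-1)).
  rewrite big_nat [leRHS]big_nat; apply: ler_sum => d /andP[d0 dN].
  rewrite /sum_inv_primes (perm_big [seq p <- index_iota 2 N.+1 | p \in primes d]); last first.
    apply: uniq_perm; rewrite ?primes_uniq ?filter_uniq ?iota_uniq// => p.
    rewrite mem_filter mem_index_iota; case: (boolP (p \in _)) => // /[!mem_primes].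
    by case/and3P => pp _ /(dvdn_leq d0) pd; rewrite prime_gt1//= (leq_ltn_trans pd).
  rewrite big_filter big_mkcond/=; apply: ler_sum => p _.
  case: ifPn => [|_]; last by rewrite mulr_ge0.
  by rewrite mem_primes => /and3P[_ _ ->]; rewrite mul1r.
rewrite exchange_big/=; under eq_bigr do rewrite -mulr_suml -natr_sum -divn_count_dvd.
apply: (@le_trans _ _ (\sum_(2 <= p < N.+1) N%:R * p%:R ^- 2)); last first.
  by rewrite -mulr_sumr mulrC ler_wpM2r// sum_inv_sqr_le.
rewrite big_nat [leRHS]big_nat; apply: ler_sum => p /andP[p2 _].
have p0 : 0 < p%:R :> R by rewrite ltr0n ltnW.
rewrite -exprVn expr2 mulrA ler_wpM2r ?invr_ge0// ler_pdivlMr// -natrM ler_nat.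
exact: leq_trunc_div.
Qed.

Lemma abel_sum_ge0 (a b : nat -> R) (N : nat) :
  (forall d e, (0 < d)%N -> (d <= e)%N -> a e <= a d) -> (forall d, 0 <= a d) ->
  (forall N, 0 <= \sum_(1 <= d < N.+1) b d) ->
  0 <= \sum_(1 <= d < N.+1) a d * b d.
Proof.
move=> a_noninc a0 b0.
suff : a N * \sum_(1 <= d < N.+1) b d <= \sum_(1 <= d < N.+1) a d * b d.
  by apply: le_trans; rewrite mulr_ge0.
elim: N => [|N IH]; first by rewrite !big_geq// mulr0.
rewrite [leRHS]big_nat_recr//= [in leLHS]big_nat_recr//= mulrDr lerD2r.
(* Monotonicity does not compare a 0 with a 1, but at that point the partial sum is empty. *)
apply: le_trans IH; case: N => [|N]; first by rewrite big_geq// !mulr0.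
by rewrite ler_wpM2r// a_noninc.
Qed.

(** The d that are not light carry at most (3/4) / (7/8) = 6/7 of the total weight, which leaves 1/7
    for the light ones. *)
Lemma sum_light_ge (a : nat -> R) (N : nat) :
  (forall d e, (0 < d)%N -> (d <= e)%N -> a e <= a d) -> (forall d, 0 <= a d) ->
  \sum_(1 <= d < N.+1) a d <= 7%:R * \sum_(1 <= d < N.+1 | light R d) a d.
Proof.
move=> a_noninc a0.
have := @abel_sum_ge0 a (fun d => 3%:R / 4%:R - sum_inv_primes d) N a_noninc a0.
have /[swap]/[apply] : forall N, 0 <= \sum_(1 <= d < N.+1) (3%:R / 4%:R - sum_inv_primes d).
  move=> K; rewrite sumrB sumr_const_nat subn1/= subr_ge0 -[leRHS]mulr_natr.
  exact: sum_inv_primes_avg.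
rewrite (eq_bigr (fun d => 3%:R / 4%:R * a d - a d * sum_inv_primes d)); last first.
  by move=> d _; ring.
rewrite sumrB -mulr_sumr subr_ge0 => H.
have H2 : 7%:R / 8%:R * \sum_(1 <= d < N.+1 | ~~ light R d) a d <=
    \sum_(1 <= d < N.+1) a d * sum_inv_primes d.
  rewrite mulr_sumr big_mkcond/=; apply: ler_sum => d _.
  have s0 : 0 <= sum_inv_primes d by apply: sumr_ge0 => p _; rewrite invr_ge0.
  case: ifPn => [|_]; last by rewrite mulr_ge0.
  by rewrite /light -ltNge => /ltW h; rewrite mulrC ler_wpM2l.
have : \sum_(1 <= d < N.+1) a d = \sum_(1 <= d < N.+1 | light R d) a d +
  \sum_(1 <= d < N.+1 | ~~ light R d) a d by rewrite (bigID (light R)).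
have : 0 <= \sum_(1 <= d < N.+1 | light R d) a d by apply: sumr_ge0.
lra.
Qed.

Lemma light1 : light R 1.
Proof. by rewrite /light big_nil divr_ge0. Qed.

Section EsumLight.
Variables (Q : choiceType) (g : Q -> nat) (w : Q -> \bar R).
Hypothesis w0 : forall q, (0 <= w q)%E.

Lemma esum_sub (A B : set Q) (f : Q -> \bar R) : (forall q, (0 <= f q)%E) -> A `<=` B ->
  (\esum_(q in A) f q <= \esum_(q in B) f q)%E.
Proof.
move=> f0 AB; rewrite esum_mkcond [leRHS]esum_mkcond; apply: le_esum => q _.
case: ifPn => [/set_mem/AB/mem_set ->//|_]; case: ifPn => //.
Qed.

Lemma sum_esum_fiber (P : pred nat) (N : nat) :
  (\sum_(1 <= d < N.+1 | P d) \esum_(q in [set q | g q = d]) w q =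
   \esum_(q in [set q | (0 < g q <= N)%N && P (g q)]) w q)%E.
Proof.
under eq_bigr do rewrite esum_mkcond.
rewrite -esum_sum; last by move=> q d _ _; case: ifP.
rewrite [RHS]esum_mkcond; apply: eq_esum => q _.
case: ifPn => [/set_mem/= /andP[gN Pg]|/negP ng].
  rewrite big_mkcond (bigD1_seq (g q)) ?mem_index_iota ?iota_uniq//= Pg mem_set//.
  rewrite big1 ?adde0// => d /negPf dg; case: ifP => // _; case: ifPn => // /set_mem/= E.
  by rewrite E eqxx in dg.
rewrite big_nat_cond big1// => d /andP[dN Pd]; case: ifPn => // /set_mem/= E.
by exfalso; apply: ng; apply: mem_set; rewrite /= E dN.
Qed.

(** If the light sum [S] is finite, so is the fibre sum at 1, since 1 is light, and by monotonicity
    at every d >= 1. The real-valued inequality then bounds each truncation g q <= N by 7 S. *)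
Lemma esum_light :
  (forall d e, (0 < d)%N -> (d <= e)%N ->
    (\esum_(q in [set q | g q = e]) w q <= \esum_(q in [set q | g q = d]) w q)%E) ->
  (\esum_(q in [set q | (0 < g q)%N]) w q = +oo)%E ->
  (\esum_(q in [set q | (0 < g q)%N && light R (g q)]) w q = +oo)%E.
Proof.
move=> w_noninc winf; apply: contrapT => /eqP; rewrite -ltey.
set S := (esum _ _) => Soo.
pose A d := (\esum_(q in [set q | g q = d]) w q)%E.
have A0 d : (0 <= A d)%E by exact: esum_ge0.
have A1 : (A 1%N < +oo)%E.
  apply: le_lt_trans Soo; apply: esum_sub => // q /= ->; exact: light1.
have Afin d : (0 < d)%N -> A d \is a fin_num.
  by move=> d0; rewrite ge0_fin_numE// (le_lt_trans _ A1)// /A w_noninc.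
pose a d := fine (A (maxn d 1)).
have aE d : (0 < d)%N -> A d = (a d)%:E.
  by move=> d0; rewrite /a (maxn_idPl d0) fineK// Afin.
have a0 d : 0 <= a d by exact: fine_ge0.
have a_noninc d e : (0 < d)%N -> (d <= e)%N -> a e <= a d.
  move=> d0 de; rewrite -lee_fin -!aE//; last exact: leq_trans de.
  exact: w_noninc.
have bound N : (\esum_(q in [set q | (0 < g q <= N)%N]) w q <= 7%:E * S)%E.
  rewrite (_ : [set _ | _] = [set q | (0 < g q <= N)%N && predT (g q)]); last first.
    by apply/seteqP; split=> q /=; rewrite andbT.
  rewrite -sum_esum_fiber.
  apply: (@le_trans _ _ (7%:E * \sum_(1 <= d < N.+1 | light R d) A d)%E).
    rewrite big_nat [X in (_ * X)%E]big_nat_cond.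
    rewrite (eq_bigr (fun d => (a d)%:E)) => [|d /andP[d0 _]]; last exact: aE.
    rewrite [X in (_ * X)%E](eq_bigr (fun d => (a d)%:E)) => [|d /andP[/andP[d0 _] _]];
      last exact: aE.
    rewrite -big_nat -big_nat_cond !sumEFin -EFinM lee_fin.
    exact: sum_light_ge.
  apply: lee_wpmul2l; first by rewrite lee_fin.
  rewrite sum_esum_fiber; apply: esum_sub => // q /= /andP[/andP[-> _] ->//].
suff : (\esum_(q in [set q | (0 < g q)%N]) w q <= 7%:E * S)%E.
  rewrite winf leye_eq => /eqP; move: Soo; rewrite -ge0_fin_numE; last exact: esum_ge0.
  by move=> Sf; rewrite -(fineK Sf) -EFinM.
apply: ge_ereal_sup => _ [F [finF FS] <-].
rewrite -esum_fset//.
have [N HN] : exists N, forall q, F q -> (g q <= N)%N.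
  have /finite_seqP[s Fs] := finF.
  exists (\max_(q <- s) g q) => q; rewrite Fs /= => qs.
  exact: leq_bigmax_seq.
apply: le_trans (bound N); apply: esum_sub => // q Fq /=.
by rewrite (HN _ Fq) andbT; exact: FS.
Qed.

End EsumLight.

Section EsumInfinite.
Variables (Q : choiceType).

(** Either psi exceeds c infinitely often, and infinitely many terms equal c^m, or truncation alters
    only finitely many terms. *)
Lemma esum_min_infinite (A : set Q) (psi : Q -> R) (c : R) (m : nat) :
  (forall q, 0 <= psi q) -> 0 < c ->
  (\esum_(q in A) (psi q ^+ m)%:E = +oo)%E ->
  (\esum_(q in A) (Num.min (psi q) c ^+ m)%:E = +oo)%E.
Proof.
move=> psi0 c0 inf; apply: contrapT => /eqP; rewrite -ltey => fin.
have w0 q : (0 <= (Num.min (psi q) c ^+ m)%:E)%E.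
  by rewrite lee_fin exprn_ge0// le_min psi0 ltW.
have p0 q : (0 <= (psi q ^+ m)%:E)%E by rewrite lee_fin exprn_ge0.
pose G := [set q | c < psi q].
have finG : finite_set (A `&` G).
  apply: contrapT => infG.
  set S := (esum _ _) in fin.
  have Sfin : S \is a fin_num by rewrite ge0_fin_numE//; exact: esum_ge0.
  have cm : 0 < c ^+ m by rewrite exprn_gt0.
  have [k kS] : exists k : nat, fine S < k%:R * c ^+ m.
    exists (Num.trunc (fine S / c ^+ m)).+1; rewrite -ltr_pdivrMr//.
    have s0 : 0 <= fine S / c ^+ m by apply: divr_ge0; [apply: fine_ge0;
      exact: esum_ge0|exact: ltW].
    by case/andP: (truncn_itv s0).
  have [B BA kB] := infinite_set_fset k infG.
  suff : ((k%:R * c ^+ m)%:E <= S)%E.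
    by rewrite -(fineK Sfin) lee_fin leNgt kS.
  apply: (@le_trans _ _ (\esum_(q in [set` B]) (Num.min (psi q) c ^+ m)%:E)%E); last first.
    by apply: esum_sub => // q /BA[].
  rewrite esum_fset// fsbig_finite//= set_fsetK.
  rewrite big_seq (eq_bigr (fun=> (c ^+ m)%:E)) => [|q qB]; last first.
    by have [_ /ltW] := BA q qB; rewrite minC => /min_idPl ->.
  rewrite -big_seq sumEFin lee_fin big_const_seq count_predT iter_addr_0 -[leRHS]mulr_natl.
  by rewrite ler_wpM2r ?(ltW cm)// ler_nat.
have : (\esum_(q in A) (psi q ^+ m)%:E <= \esum_(q in A `&` G) (psi q ^+ m)%:E +
    \esum_(q in A) (Num.min (psi q) c ^+ m)%:E)%E.
  rewrite (esumID G)//; apply: leeD => //.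
  apply: (@le_trans _ _ (\esum_(q in A `&` ~` G) (Num.min (psi q) c ^+ m)%:E)%E).
    apply: le_esum => q [_ /= /negP]; rewrite -leNgt => pc.
    by rewrite (min_idPl pc).
  by apply: esum_sub => // q [].
rewrite inf leye_eq => /eqP; rewrite esum_fset// fsbig_finite//= sumEFin.
by case: (esum _ _) fin.
Qed.

Lemma esum_exists_infinite (I : finType) (A : set Q) (B : I -> set Q) (w : Q -> \bar R) :
  (forall q, 0 <= w q)%E -> (forall q, A q -> exists i, B i q) ->
  (\esum_(q in A) w q = +oo)%E -> exists i, (\esum_(q in A `&` B i) w q = +oo)%E.
Proof.
move=> w0 AB inf; apply: contrapT => nB.
have Bfin i : (\esum_(q in A `&` B i) w q < +oo)%E.
  by rewrite ltey; apply/eqP => h; apply: nB; exists i.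
have : (\esum_(q in A) w q <= \sum_(i : I) \esum_(q in A `&` B i) w q)%E.
  under [leRHS]eq_bigr do rewrite esum_mkcondr.
  rewrite -esum_sum; last by move=> q i _ _; case: ifP.
  apply: le_esum => q /AB[i Biq]; rewrite (bigD1 i)//= mem_set// leeDl//.
  by apply: sume_ge0 => j _; case: ifP.
rewrite inf leye_eq => /eqP sumy.
have : (\sum_(i : I) \esum_(q in A `&` B i) w q < +oo)%E by apply: lte_sum_pinfty.
by rewrite sumy.
Qed.

Lemma esum_infinite_seq (A B : set Q) (w : Q -> R) (M : R) : (forall q, 0 <= w q) ->
  finite_set B -> (\esum_(q in A) (w q)%:E = +oo)%E ->
  exists s : seq Q, [/\ uniq s, forall q, q \in s -> A q /\ ~ B q & M <= \sum_(q <- s) w q].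
Proof.
move=> w0 finB inf.
have wE q : (0 <= (w q)%:E)%E by rewrite lee_fin.
have : (\esum_(q in A `&` ~` B) (w q)%:E = +oo)%E.
  move: inf; rewrite (esumID B)// esum_fset; [|exact: finite_setIr|by []].
  rewrite fsbig_finite/=; last exact: finite_setIr.
  by rewrite sumEFin; case: (esum _ _).
rewrite /esum => sup_inf.
have : (M%:E < ereal_sup [set (\sum_(q \in F) (w q)%:E)%E | F in fsets (A `&` ~` B)])%E.
  by rewrite sup_inf ltry.
move=> /ereal_sup_gt[_ [F [finF FAB] <-]]; rewrite fsbig_finite//= sumEFin lte_fin => MF.
exists (fset_set F); split; [exact: fset_uniq| |exact: ltW].
by move=> q; rewrite in_fset_set// => /set_mem/FAB.
Qed.

End EsumInfinite.

End Divergence.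

(** * Second moments and sets of full measure *)

Section SecondMoment.
Local Open Scope ereal_scope.
Context (R : realType) d (X : measurableType d) (mu : {measure set X -> \bar R}).

(** The integral of 2 theta N 1_D <= N^2 + theta^2 1_D, where N counts the [A i] containing the
    point. This is Cauchy-Schwarz with a free parameter instead of square roots. *)
Lemma sum_measureI_le (I : Type) (s : seq I) (A : I -> set X) (D : set X) (theta : R) :
  (0 <= theta)%R -> (forall i, measurable (A i)) -> measurable D ->
  (2 * theta)%:E * (\sum_(i <- s) mu (A i `&` D)) <=
    \sum_(i <- s) \sum_(j <- s) mu (A i `&` A j) + (theta ^+ 2)%:E * mu D.
Proof.
move=> t0 mA mD.
have t2 : (0 <= 2 * theta)%R by rewrite mulr_ge0.
have muE E : measurable E -> mu E = \int[mu]_x (\1_E x)%:E.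
  by move=> mE; rewrite integral_indic// setIT.
have mind E : measurable E -> measurable_fun [set: X] (fun x : X => (\1_E x : R)%:E).
  by move=> mE; apply/measurable_EFinP; exact: measurable_indic.
have mAD i : measurable (A i `&` D) by exact: measurableI.
have mAA i j : measurable (A i `&` A j) by exact: measurableI.
have ind0 E x : 0 <= (\1_E x)%:E :> \bar R by rewrite lee_fin.
rewrite (eq_bigr (fun i => \int[mu]_x (\1_(A i `&` D) x)%:E)) => [|i _]; last exact: muE.
rewrite -ge0_integral_sum//; last by move=> i; exact: mind.
rewrite -ge0_integralZl_EFin//; first last.
- by apply: emeasurable_sum => i; exact: mind.
- by move=> x _; exact: sume_ge0.
rewrite (eq_bigr (fun i => \int[mu]_x (\sum_(j <- s) (\1_(A i `&` A j) x)%:E))); last first.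
  move=> i _; rewrite ge0_integral_sum//; last by move=> j; exact: mind.
  by apply: eq_bigr => j _; exact: muE.
rewrite -ge0_integral_sum//; first last.
- by move=> i x _; exact: sume_ge0.
- by move=> i; apply: emeasurable_sum => j; exact: mind.
rewrite (muE D)// -ge0_integralZl_EFin//; [|exact: mind|exact: exprn_ge0].
have mdbl : measurable_fun [set: X]
    (fun x : X => \sum_(i <- s) \sum_(j <- s) (\1_(A i `&` A j) x : R)%:E).
  by apply: emeasurable_sum => i; apply: emeasurable_sum => j; exact: mind.
have mtD : measurable_fun [set: X] (fun x : X => (theta ^+ 2)%:E * (\1_D x : R)%:E).
  by apply: measurable_funeM; exact: mind.
have s0 x : 0 <= \sum_(i <- s) \sum_(j <- s) (\1_(A i `&` A j) x)%:E :> \bar R.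
  by apply: sume_ge0 => i _; apply: sume_ge0.
have tD0 x : 0 <= (theta ^+ 2)%:E * (\1_D x)%:E :> \bar R.
  by rewrite mule_ge0// lee_fin exprn_ge0.
rewrite -ge0_integralD//; apply: ge0_le_integral => //.
- by move=> x _; rewrite mule_ge0 ?lee_fin//; exact: sume_ge0.
- by apply: measurable_funeM; apply: emeasurable_sum => i; exact: mind.
- exact: emeasurable_funD.
move=> x _.
under [X in _ <= X + _]eq_bigr do rewrite sumEFin.
rewrite !sumEFin -!EFinM -EFinD lee_fin.
have -> : (\sum_(i <- s) \1_(A i `&` D) x = (\sum_(i <- s) \1_(A i) x) * \1_D x :> R)%R.
  by rewrite mulr_suml; apply: eq_bigr => i _; rewrite indicI.
have -> : (\sum_(i <- s) \sum_(j <- s) \1_(A i `&` A j) x =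
    (\sum_(i <- s) \1_(A i) x) ^+ 2 :> R)%R.
  rewrite expr2 mulr_suml; apply: eq_bigr => i _; rewrite mulr_sumr.
  by apply: eq_bigr => j _; rewrite indicI.
set N := (\sum_(i <- s) _)%R.
have := sqr_ge0 (N - theta); have := sqr_ge0 N.
by rewrite indicE; case: (x \in D); rewrite !expr2 /=; nra.
Qed.

End SecondMoment.

(** * Sets that avoid the approximation sets *)

Section FullMeasure.
Context (R : realType) (n m : nat).
Local Notation T := (measurableTypeR R).
Local Notation leb := (lebesgue_tuple R).
Local Notation Omega := ((n * m).-tuple T).
Local Notation cube := (@unit_cube R (n * m)).

(** Fixing the position of a largest entry lets one direction of translation serve all [q]: outside
    a finite set of [q], the speed [q ord0 i] is as large as desired. *)
Definition light_max_rows (i : 'I_n) : set 'rV[nat]_n :=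
  [set q | ((0 < gcd_row q)%N && light R (gcd_row q)) /\ forall j, (q ord0 j <= q ord0 i)%N].

Lemma light_max_rows_gt0 i q : light_max_rows i q -> (0 < q ord0 i)%N.
Proof.
move=> [/andP[d0 _] qi]; rewrite lt0n; apply: contraTN d0 => /eqP qi0.
rewrite -leqNgt leqn0 /gcd_row big1// => j _; apply/eqP.
by have := qi j; rewrite qi0 leqn0.
Qed.

Lemma finite_row_le (K : nat) : finite_set [set q : 'rV[nat]_n | forall j, (q ord0 j <= K)%N].
Proof.
apply: (@sub_finite_set _ _ (range (fun f : {ffun 'I_n -> 'I_K.+1} => \row_j (f j : nat)))).
  move=> q qK; exists [ffun j => inord (q ord0 j)] => //.
  by apply/rowP => j; rewrite mxE ffunE inordK ?ltnS.
by apply: finite_image; exact: finite_finset.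
Qed.

Lemma approx_set_pair q r (s tau : R) : 0 <= s -> 0 <= tau ->
  (0 < gcd_row q)%N -> (0 < gcd_row r)%N -> q != r ->
  (leb (n * m) ((approx_set q s `&` approx_set (m := m) r tau) `&` cube) <=
    ((36 * (s * tau)) ^+ m)%:E)%E.
Proof.
move=> s0 t0 dq dr qr.
have st0 : 0 <= s * tau by rewrite mulr_ge0.
have [[i [j ij]]|par] := pselect (exists i j, q ord0 j * r ord0 i < q ord0 i * r ord0 j)%N.
  exact: approx_set_nonparallel ij.
have pq (i j : 'I_n) : (q ord0 i * r ord0 j = q ord0 j * r ord0 i)%N.
  apply/eqP; rewrite eqn_leq; apply/andP; split; rewrite leqNgt; apply/negP => h; apply: par.
    by exists i, j.
  by exists j, i.
apply: (le_trans (approx_set_parallel m s0 t0 dq dr qr pq)).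
by rewrite lee_fin lerXn2r// ?nnegrE ?mulr_ge0//; lra.
Qed.

(** With M the sum of the s(q)^m, off-diagonal pairs contribute at most 36^m M^2 and the diagonal at
    most 36^m M, which M >= 1 absorbs into a second 36^m M^2. *)
Lemma approx_set_sum_pairs (s : 'rV[nat]_n -> R) (F : seq 'rV[nat]_n) :
  uniq F -> (forall q, 0 <= s q) -> (forall q, q \in F -> (0 < gcd_row q)%N) ->
  1 <= \sum_(q <- F) s q ^+ m ->
  (\sum_(q <- F) \sum_(r <- F)
     leb (n * m) ((approx_set q (s q) `&` approx_set (m := m) r (s r)) `&` cube) <=
   (2 * 36 ^+ m * (\sum_(q <- F) s q ^+ m) ^+ 2)%:E)%E.
Proof.
move=> uF s0 gF; set M := \sum_(q <- F) _ => M1.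
have row q : q \in F -> (\sum_(r <- F)
    leb (n * m) ((approx_set q (s q) `&` approx_set (m := m) r (s r)) `&` cube) <=
    (36 ^+ m * s q ^+ m + 36 ^+ m * s q ^+ m * M)%:E)%E.
  move=> qF; rewrite (big_rem q)//= EFinD; apply: leeD.
    have [i qi] : exists i, (0 < q ord0 i)%N.
      apply: contrapT => nq; have := gF q qF; rewrite /gcd_row big1// => i _.
      by apply/eqP; rewrite -leqn0 leqNgt; apply/negP => h; apply: nq; exists i.
    rewrite setIid; apply: (le_trans (approx_set_le m (gcd_row_dvd q) qi (s0 q))).
    rewrite lee_fin -exprMn lerXn2r// ?nnegrE ?mulr_ge0//.
    by rewrite ler_wpM2r// ler_nat.
  apply: (@le_trans _ _ (\sum_(r <- rem q F) (36 ^+ m * s q ^+ m * s r ^+ m)%:E)%E).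
    rewrite big_seq [leRHS]big_seq; apply: lee_sum => r; rewrite mem_rem_uniq// => /andP[rq rF].
    rewrite -!exprMn -mulrA; apply: approx_set_pair; rewrite ?gF//.
    by rewrite eq_sym.
  rewrite sumEFin lee_fin -mulr_sumr ler_wpM2l ?mulr_ge0 ?exprn_ge0//.
  by rewrite /M [leRHS](big_rem q)//= lerDr exprn_ge0.
apply: (@le_trans _ _ (\sum_(q <- F) (36 ^+ m * s q ^+ m + 36 ^+ m * s q ^+ m * M)%:E)%E).
  by rewrite big_seq [leRHS]big_seq; exact: lee_sum.
rewrite sumEFin lee_fin big_split/= -mulr_suml -mulr_sumr -/M.
have c0 : 0 <= 36 ^+ m * M :> R by rewrite mulr_ge0 ?exprn_ge0// (le_trans _ M1).
have := ler_wpM2l c0 M1; rewrite mulr1; lra.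
Qed.

Lemma tadd_rank1_tupleK (i : 'I_n) (X : Omega) t :
  tadd (tadd X (rank1_tuple (unit_row R i) t)) (rank1_tuple (fun l => - unit_row R i l) t) = X.
Proof.
apply: eq_from_tnth => l; case/mxvec_indexP: l => a b.
by rewrite !tnth_tadd !tnth_rank1_tuple mulNr addrK.
Qed.

Lemma periodic_tadd k (E : set (k.-tuple T)) h : periodic E -> periodic [set X | E (tadd X h)].
Proof.
by move=> pE X Y XY; apply: pE => i; rewrite !tnth_tadd opprD addrACA subrr addr0.
Qed.

Lemma periodicC k (E : set (k.-tuple T)) : periodic E -> periodic (~` E).
Proof.
by move=> pE X Y XY nEX EY; apply: nEX; apply: pE EY => i; rewrite -rpredN opprB.
Qed.

Lemma exists_nat_ge (x : R) : exists K : nat, x <= K%:R.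
Proof.
have [x0|/ltW x0] := leP 0 x; last by exists 0%N.
by exists (Num.trunc x).+1; case/andP: (truncn_itv x0) => _ /ltW.
Qed.

(* This takes the place of a zero-one law. For each q, small translations of B
   along row i meet the approximation set with average proportion at least
   c s(q)^m; as B itself avoids the set, the meeting points lie in the defect
   (B + h) \ B, whose measure is at most eps. The second moment bound makes its
   contribution, summed over q, negligible against \sum_q s(q)^m. *)
Lemma avoid_approx_set_null (i : 'I_n) (s : 'rV[nat]_n -> R) (N : nat) (B : set Omega) :
  (forall q, 0 <= s q <= 1 / 2) ->
  (\esum_(q in light_max_rows i) (s q ^+ m)%:E = +oo)%E ->
  measurable B -> periodic B ->
  (forall q, light_max_rows i q -> (N <= pickle q)%N -> B `&` approx_set q (s q) = set0) ->
  leb (n * m) (B `&` cube) = 0%E.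
Proof.
move=> s01 sinf mB pB Bdisj; apply/eqP; rewrite eq_le measure_ge0 andbT leNgt; apply/negP.
have s0 q : 0 <= s q by case/andP: (s01 q).
have mc := @measurable_unit_cube R (n * m).
have mBc := measurableI _ _ mB mc.
have Bfin : leb (n * m) (B `&` cube) \is a fin_num.
  rewrite ge0_fin_numE//; apply: (@le_lt_trans _ _ (leb (n * m) cube)).
    by apply: le_measure; rewrite ?inE//; exact: subIsetr.
  by rewrite lebesgue_unit_cube ltry.
rewrite -(fineK Bfin) lte_fin; set beta := fine _ => beta0.
pose C : R := 2 * 36 ^+ m; pose c : R := (1 / 16) ^+ m.
have C0 : 0 < C by rewrite mulr_gt0// exprn_gt0.
have c0 : 0 < c by rewrite exprn_gt0// divr_gt0.
have cb0 : 0 < c * beta by rewrite mulr_gt0.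
(* theta and eps make C / (2 theta) + theta eps / 2 equal to c beta / 2 *)
pose theta := 2 * C / (c * beta).
have th0 : 0 < theta by rewrite divr_gt0// mulr_gt0.
pose eps := c * beta / (2 * theta).
have eps0 : 0 < eps by rewrite divr_gt0// mulr_gt0.
have [delta d01 Hdelta] := small_translation_measurable mB eps0.
have [d0 d1] := andP d01.
have [K KE] := exists_nat_ge (2048 / delta ^+ 2).
(* Outside [ex] the largest entry exceeds [K], so the local lower bound applies, and [Bdisj] is
   available. *)
pose ex := [set q : 'rV[nat]_n | forall j, (q ord0 j <= K)%N] `|` [set q | (pickle q < N)%N].
have finex : finite_set ex.
  rewrite finite_setU; split; first exact: finite_row_le.
  apply: (@sub_finite_set _ _ (pickle @^-1` `I_N)) => //.
  by apply: finite_preimage => [x y _ _|]; [exact: (pcan_inj pickleK)|exact: finite_II].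
have [F [uF FQ M1]] := esum_infinite_seq 1 (fun q => exprn_ge0 m (s0 q)) finex sinf.
set M := \sum_(q <- F) _ in M1.
have M0 : 0 < M by exact: lt_le_trans M1.
have bmeas : measurable (box m `[0%R, delta[%classic) by apply: measurable_box_cst;
  exact: measurable_itv.
pose G (q : 'rV[nat]_n) := [set p : Omega * m.-tuple T | (B p.1 /\ cube p.1) /\
  (approx_set q (s q) (tadd p.1 (rank1_tuple (unit_row R i) p.2)) /\ box m `[0%R, delta[%classic p.2)].
have mG q : measurable (G q).
  by apply: measurable_translates => //; exact: measurable_approx_set.
(* The bound from [sum_measureI_le] with parameter M theta: (C M^2 + (M theta)^2 eps) / (2 M
   theta). *)
pose b : R := M * (C / (2 * theta) + theta * eps / 2).
have b0 : 0 <= b.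
  apply: mulr_ge0; first exact: ltW.
  apply: addr_ge0; apply: divr_ge0 => //; first exact: ltW.
    by apply: mulr_ge0 => //; exact: ltW.
  by apply: mulr_ge0; exact: ltW.
have upper t : box m `[0%R, delta[%classic t ->
    (\sum_(q <- F) leb (n * m) [set X | G q (X, t)] <= b%:E)%E.
  move=> bt; set h := rank1_tuple (unit_row R i) t.
  set h' : Omega := rank1_tuple (fun l => - unit_row R i l) t.
  have hK X : tadd (tadd X h) h' = X by exact: tadd_rank1_tupleK.
  pose E := [set Y | B (tadd Y h')] `&` ~` B.
  have mE : measurable E.
    by apply: measurableI; [exact: measurable_preimage_tadd|exact: measurableC].
  have pE : periodic E by apply: periodicI; [exact: periodic_tadd|exact: periodicC].
  pose mu := mrestr (leb (n * m)) mc.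
  have muE A : mu A = leb (n * m) (A `&` cube) by [].
  have Eeps : (mu E <= eps%:E)%E.
    have hb : box (n * m) `[0%R, delta[%classic h.
      move=> l; case/mxvec_indexP: l => a l; rewrite /h tnth_rank1_tuple /unit_row.
      by case: (a == i); rewrite ?mul1r ?mul0r; [exact: bt|rewrite /= in_itv/= lexx d0].
    apply: le_trans (Hdelta _ hb); rewrite muE -(lebesgue_cube_tadd h mE pE).
    apply: le_measure; rewrite ?inE.
    - by apply: measurableI => //; exact: measurable_preimage_tadd.
    - by apply: measurableI => //; exact: measurable_translation_defect.
    - move=> X [[/= BX nBX] cX]; split=> // -[BXh _]; apply: nBX; apply: BXh.
      by move: BX; rewrite hK.
  (* If X lies in [B] and X + h in the approximation set, then X + h is outside [B], hence in [E];
     translation by [h] preserves the measure. *)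
  have mono : (\sum_(q <- F) leb (n * m) [set X | G q (X, t)] <=
      \sum_(q <- F) mu (approx_set q (s q) `&` E))%E.
    rewrite big_seq [leRHS]big_seq; apply: lee_sum => q qF.
    have [Qq nex] := FQ q qF.
    have mqE : measurable (approx_set q (s q) `&` E) by apply: measurableI => //;
      exact: measurable_approx_set.
    have pqE : periodic (approx_set q (s q) `&` E) by apply: periodicI => //;
      exact: periodic_approx_set.
    rewrite muE -(lebesgue_cube_tadd h mqE pqE).
    apply: le_measure; rewrite ?inE.
    - rewrite -[X in measurable X]setTI; exact: (pair2_measurable t measurableT (mG q)).
    - by apply: measurableI => //; exact: measurable_preimage_tadd.
    - move=> X /= [[BX cX] [AX _]]; split=> //; split=> //; split; first by rewrite /= hK.
      move=> BXh; have Nq : (N <= pickle q)%N.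
        by rewrite leqNgt; apply/negP => h0; apply: nex; right.
      by have /seteqP[/(_ _ (conj BXh AX))] := Bdisj q Qq Nq.
  apply: (le_trans mono).
  have Mt0 : 0 <= M * theta by rewrite mulr_ge0 ?ltW.
  have F0 q : q \in F -> (0 < gcd_row q)%N by move=> /FQ[[/andP[? _] _] _].
  have sp : (\sum_(q <- F) \sum_(r <- F) mu (approx_set q (s q) `&` approx_set r (s r)) <=
      (C * M ^+ 2)%:E)%E := approx_set_sum_pairs uF s0 F0 M1.
  have t2 : (0 <= ((M * theta) ^+ 2)%:E)%E by rewrite lee_fin exprn_ge0.
  have H := le_trans (@sum_measureI_le _ _ _ mu _ F (fun q => approx_set q (s q)) E _ Mt0
    (fun q => measurable_approx_set q (s q)) mE) (leeD sp (lee_wpmul2l t2 Eeps)).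
  have Mt2 : 0 < 2 * (M * theta) by apply: mulr_gt0 => //; exact: mulr_gt0.
  rewrite -(@lee_pmul2l _ (2 * (M * theta))%:E)// ?lte_fin//.
  apply: (le_trans H); rewrite -!EFinM -EFinD lee_fin le_eqVlt; apply/orP; left.
  by apply/eqP; rewrite /b; field; rewrite gt_eqF.
have lower : ((\sum_(q <- F) (s q * delta / 16) ^+ m)%:E * leb (n * m) (B `&` cube) <=
    b%:E * leb m (box m `[0%R, delta[%classic))%E.
  rewrite -sumEFin; apply: (@tonelli_set_sum_ge _ _ _ _ _ (leb (n * m)) (leb m) _ F G) => //.
  - by move=> q X t [_ []].
  - move=> q _; rewrite lee_fin; apply: exprn_ge0; apply: divr_ge0 => //.
    by apply: mulr_ge0 => //; exact: ltW.
  - move=> q X qF [BX cX]; have [Qq nex] := FQ q qF.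
    have qi0 := light_max_rows_gt0 Qq.
    have [/andP[dq lq] qmax] := Qq.
    have qK : (K <= q ord0 i)%N.
      rewrite leqNgt; apply/negP => qK; apply: nex; left => j.
      by apply: leq_trans (qmax j) _; exact: ltnW.
    have qN : 2048 / delta ^+ 2 <= (q ord0 i)%:R by apply: (le_trans KE); rewrite ler_nat.
    apply: (le_trans (approx_set_translates_ge X qi0 lq d01 (s01 q) qN)).
    apply: le_measure; rewrite ?inE.
    + apply: measurableI => //; rewrite -[Y in measurable Y]setTI.
      apply: (@measurable_tadd R (n * m) _ _ (cst X) (rank1_tuple (unit_row R i))) => //.
        exact: measurable_rank1_tuple.
      exact: measurable_approx_set.
    + rewrite -[Y in measurable Y]setTI; exact: (pair1_measurable X measurableT (mG q)).
    + by move=> t [At bt].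
have muB : leb (n * m) (B `&` cube) = beta%:E by rewrite fineK.
have boxE := @lebesgue_tuple_box_itv R m delta (ltW d0).
move: lower; rewrite muB boxE -!EFinM lee_fin.
under eq_bigr do rewrite -mulrA exprMn.
rewrite -mulr_suml -/M (_ : (delta / 16) ^+ m = c * delta ^+ m); last first.
  by rewrite /c -exprMn; congr (_ ^+ _); ring.
have dm0 : 0 < delta ^+ m by rewrite exprn_gt0.
(* The power of delta cancels, so theta and eps could be fixed before delta. *)
rewrite (_ : M * (c * delta ^+ m) * beta = M * (c * beta) * delta ^+ m); last by ring.
rewrite ler_pM2r// /b ler_pM2l// leNgt => /negP; apply.
have -> : C / (2 * theta) = c * beta / 4 by rewrite /theta; field; rewrite ?gt_eqF.
have -> : theta * eps / 2 = c * beta / 4 by rewrite /eps; field; rewrite ?gt_eqF.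
lra.
Qed.

End FullMeasure.

(** * The torus *)

Section Torus.
Context (R : realType) (n m : nat) (hm : (0 < m)%N).
Local Notation T := (measurableTypeR R).
Local Notation leb := (lebesgue_tuple R).
Local Notation Omega := ((n * m).-tuple T).
Local Notation cube := (@unit_cube R (n * m)).
Implicit Types (X : Omega) (q : 'rV[nat]_n).

Lemma approximatesP X q (p : 'rV[int]_m) (e : R) :
  approximates (mx_of_tuple X) q p e <->
  forall j, `|linear_form q X j - (p ord0 j)%:~R| < e.
Proof.
have entry j : (map_mx (fun k => k%:R) q *m mx_of_tuple X - map_mx intr p) ord0 j =
    linear_form q X j - (p ord0 j)%:~R.
  by rewrite !mxE; congr (_ - _); apply: eq_bigr => i _; rewrite !mxE.
rewrite /approximates [Num.norm _]/Num.norm /= mx_normrE; split.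
  by move=> /bigmax_ltP[_ h] j; rewrite -entry; exact: (h (ord0, j)).
move=> h; apply/bigmax_ltP; split=> [|[i j] _ /=].
  (* The maximum starts at 0, so 0 < e is needed and is read off from some coordinate. *)
  exact: le_lt_trans (normr_ge0 _) (h (Ordinal hm)).
by rewrite (ord1 i) entry.
Qed.

Variables (P : 'rV[int]_n -> set 'rV[int]_m) (hP : forall z, P z = setT).
Variable psi : 'rV[nat]_n -> R.

(** The good [q] belong to some representative [Y] of the class of [X]; periodicity with d = 1
    transfers them to [X]. *)
Lemma preimage_W_approx X (N : nat) : (@torus_of_tuple R n m @^-1` W P psi) X ->
  exists2 q, (N <= pickle q)%N & coprime_approx_set 1 q (psi q) X.
Proof.
move=> [Y infY /(@eqquotP _ _ (torus R n m))/mxOverP YX].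
pose Y' : Omega := [tuple mxvec Y ord0 l | l < n * m].
have YE : Y = mx_of_tuple Y'.
  by apply/matrixP => i j; rewrite mxE tnth_mktuple mxvecE.
have /infinite_set_pickle/(_ N)[q Nq [p _ qp]] := infY; exists q => //.
apply: (@periodic_coprime_approx_set R n m 1 q (psi q) (fun=> dvd1n _) Y').
  move=> l; case/mxvec_indexP: l => i j; rewrite tnth_mktuple mxvecE.
  by have := YX i j; rewrite !mxE.
move: qp; rewrite YE => /approximatesP qp j.
exact: near_coprime1 (qp j).
Qed.

Lemma approx_preimage_W (s : 'rV[nat]_n -> R) X : (forall q, s q <= psi q) ->
  (forall N, exists2 q, (N <= pickle q)%N & approx_set q (s q) X) ->
  (@torus_of_tuple R n m @^-1` W P psi) X.
Proof.
move=> s_psi H; exists (mx_of_tuple X) => //; apply/infinite_set_pickle => N.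
have [q Nq AX] := H N; exists q => //=.
have /choice[p pP] : forall j, exists p : int, `|linear_form q X j - p%:~R| < s q.
  by move=> j; have [p _ ?] := AX j; exists p.
exists (\row_j p j); first by rewrite hP.
by apply/approximatesP => j; rewrite mxE; apply: lt_le_trans (pP j) _.
Qed.

Lemma measurable_preimage_W : measurable (@torus_of_tuple R n m @^-1` W P psi).
Proof. exact: (measurable_W P psi). Qed.

Lemma torus_LebE : torus_Leb (W P psi) =
  leb (n * m) (@torus_of_tuple R n m @^-1` W P psi `&` cube).
Proof. by []. Qed.

Hypothesis psi_ge0 : forall q, 0 <= psi q.

Lemma torus_Leb_W0 : (\esum_(q in setT) (psi q ^+ m)%:E < +oo)%E ->
  torus_Leb (W P psi) = 0%E.
Proof.
move=> fin; have mc := @measurable_unit_cube R (n * m).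
(* The row q = 0 is set aside: if psi(0) > 0, every matrix satisfies its condition, whatever the
   size of psi(0). *)
pose F (k : nat) : set Omega := if @pickle_inv 'rV[nat]_n k is Some q then
  if q == 0 then set0 else coprime_approx_set 1 q (psi q) else set0.
pose a (k : nat) : \bar R := if @pickle_inv 'rV[nat]_n k is Some q then
  ((6 ^+ m)%:E * (psi q ^+ m)%:E)%E else 0%E.
have mF k : measurable (F k).
  rewrite /F; case: pickle_inv => [q|//]; case: ifP => // _.
  exact: measurable_coprime_approx_set.
have a0 k : (0 <= a k)%E.
  rewrite /a; case: pickle_inv => [q|//].
  by rewrite mule_ge0// lee_fin exprn_ge0.
pose mu : {measure set Omega -> \bar R} := mrestr (leb (n * m)) mc.
have Fa k : (mu (F k) <= a k)%E.
  rewrite /F /a; case: pickle_inv => [q|]; last by rewrite measure0.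
  have c0 : (0 <= (6 ^+ m)%:E * (psi q ^+ m)%:E)%E by rewrite mule_ge0// lee_fin exprn_ge0.
  case: eqP => [_|/eqP q0]; first by rewrite measure0.
  have [i qi] : exists i, (0 < q ord0 i)%N.
    apply: contrapT => nq; case/eqP: q0; apply/rowP => i; rewrite mxE.
    by apply/eqP; rewrite -leqn0 leqNgt; apply/negP => h; apply: nq; exists i.
  rewrite -EFinM -exprMn; exact: approx_set_le (fun=> dvd1n _) qi (psi_ge0 q).
have suma : (\sum_(0 <= k <oo) mu (F k) < +oo)%E.
  apply: (@le_lt_trans _ _ (\sum_(0 <= k <oo) a k)%E).
    by apply: lee_nneseries => // k _ _; exact: Fa.
  rewrite nneseries_esumT//.
  have -> : (\esum_(k in setT) a k = \esum_(k in range (@pickle 'rV[nat]_n)) a k)%E.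
    rewrite [RHS]esum_mkcond; apply: eq_esum => k _; case: ifPn => // /negP nk.
    rewrite /a; case E: pickle_inv => [q|//]; exfalso; apply: nk; apply: mem_set.
    exists q => //; have := @pickle_invK 'rV[nat]_n k; by rewrite E.
  rewrite esum_image; last by move=> x y _ _; exact: (pcan_inj pickleK).
  rewrite (eq_esum (b := fun q => ((6 ^+ m)%:E * (psi q ^+ m)%:E)%E)) => [|q _]; last first.
    by rewrite /a pickleK_inv.
  apply: (@le_lt_trans _ _ ((6 ^+ m)%:E * \esum_(q in [set: 'rV[nat]_n]) (psi q ^+ m)%:E)%E).
    apply: ge_ereal_sup => _ [A [finA _] <-].
    rewrite -ge0_mule_fsumr => [|q]; last by rewrite lee_fin exprn_ge0.
    apply: lee_wpmul2l; first by rewrite lee_fin exprn_ge0.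
    by apply: esum_ge; exists A.
  exact: lte_mul_pinfty.
have mu0 : mu (lim_sup_set F) = 0%E := lim_sup_set_cvg0 mF suma.
rewrite torus_LebE.
apply/eqP; rewrite eq_le measure_ge0 andbT.
apply: (@le_trans _ _ (mu (lim_sup_set F))); last by rewrite mu0.
apply: le_measure; rewrite ?inE.
- by apply: measurableI => //; exact: measurable_preimage_W.
- apply: measurableI => //; apply: bigcapT_measurable => k.
  by apply: bigcup_measurable.
- move=> X [VX cX]; split=> // N _.
  (* Starting beyond the code of 0 ensures that [q] is nonzero. *)
  have [q Nq qX] := preimage_W_approx (maxn N (pickle (0 : 'rV[nat]_n)).+1) VX.
  exists (pickle q) => /=; first by apply: leq_trans Nq; exact: leq_maxl.
  rewrite /F pickleK_inv; case: eqP => // q0; move: Nq; rewrite q0.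
  by rewrite geq_max ltnn andbF.
Qed.

Hypothesis hn : (0 < n)%N.

Lemma torus_Leb_W1 : (\esum_(q in setT) (psi q ^+ m)%:E = +oo)%E ->
  (forall d e : nat, (0 < d)%N -> (d <= e)%N -> (Psi m psi e <= Psi m psi d)%E) ->
  torus_Leb (W P psi) = 1%E.
Proof.
move=> inf Psi_noninc; have mc := @measurable_unit_cube R (n * m).
have w0 q : (0 <= (psi q ^+ m)%:E)%E by rewrite lee_fin exprn_ge0.
pose Sd d := (\esum_(q in [set q : 'rV[nat]_n | gcd_row q = d]) (psi q ^+ m)%:E)%E.
(* Raising Psi to the power m undoes the root, including at the value +oo. *)
have Sd_noninc d e : (0 < d)%N -> (d <= e)%N -> (Sd e <= Sd d)%E.
  move=> d0 de; have S0 k : (0 <= Sd k)%E by exact: esum_ge0.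
  have PsiK k : ((Psi m psi k) `^ m%:R)%E = Sd k.
    rewrite /Psi -poweRrM mulVf; first by rewrite poweRe1 ?S0.
    by rewrite pnatr_eq0 -lt0n.
  rewrite -!PsiK; apply: gt0_ler_poweR => //; last exact: Psi_noninc.
    by rewrite in_itv/= poweR_ge0 leey.
  by rewrite in_itv/= poweR_ge0 leey.
(* The gcd vanishes only at q = 0, a single finite term. *)
have infpos : (\esum_(q in [set q | (0 < gcd_row q)%N]) (psi q ^+ m)%:E = +oo)%E.
  move: inf; rewrite (esumID [set (0 : 'rV[nat]_n)])// setTI esum_set1// setTI.
  rewrite (_ : ~` [set 0] = [set q | (0 < gcd_row q)%N]).
    by case: (esum _ _).
  apply/seteqP; split=> q /= q0; last by move=> qE; move: q0;
    rewrite qE /gcd_row big1// => i _; rewrite mxE.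
  rewrite lt0n; apply/eqP => dq0; apply: q0; apply/rowP => i; rewrite mxE.
  by have := gcd_row_dvd q i; rewrite dq0 dvd0n => /eqP.
have inflight := esum_light w0 Sd_noninc infpos.
pose s q := Num.min (psi q) (1 / 2).
have s01 q : 0 <= s q <= 1 / 2.
  by rewrite /s le_min psi_ge0 ge_min lexx orbT andbT divr_ge0.
have [i infi] : exists i, (\esum_(q in light_max_rows R i) (s q ^+ m)%:E = +oo)%E.
  have sw0 q : (0 <= (s q ^+ m)%:E)%E by rewrite lee_fin exprn_ge0//; case/andP: (s01 q).
  have c0 : 0 < 1 / 2 :> R by rewrite divr_gt0.
  have := esum_exists_infinite (B := fun (i : 'I_n) (q : 'rV[nat]_n) =>
    forall j, (q ord0 j <= q ord0 i)%N) sw0 _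
    (esum_min_infinite psi_ge0 c0 inflight).
  apply=> q _; have := @arg_maxnP 'I_n (Ordinal hn) xpredT (fun j => q ord0 j) isT.
  by case=> i _ H; exists i => j; exact: H.
pose V := @torus_of_tuple R n m @^-1` W P psi.
have mV : measurable V := measurable_preimage_W.
pose B (N : nat) : set Omega :=
  ~` \bigcup_(q in [set q | light_max_rows R i q /\ (N <= pickle q)%N])
  approx_set q (s q).
have mB N : measurable (B N).
  apply: measurableC; apply: measurable_bigcup_countable => q.
  exact: measurable_approx_set.
have B0 N : leb (n * m) (B N `&` cube) = 0%E.
  apply: (avoid_approx_set_null (N := N) s01 infi (mB N)).
    apply: periodicC => X Y XY [q Qq AX]; exists q => //.
    exact: (periodic_approx_set XY).
  move=> q Qq Nq; apply/seteqP; split=> X // [nX AX].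
  by apply: nX; exists q.
have nV : ~` V `<=` \bigcup_N B N.
  move=> X; apply: contra_notP => nB; apply: (@approx_preimage_W s).
    by move=> q; rewrite /s ge_min lexx.
  move=> N; apply: contrapT => nq; apply: nB; exists N => // -[q [_ Nq] AX].
  by apply: nq; exists q.
pose mu : {measure set Omega -> \bar R} := mrestr (leb (n * m)) mc.
have muB : mu (\bigcup_N B N) = 0%E.
  apply/eqP; rewrite eq_le measure_ge0 andbT.
  apply: (le_trans (@measure_sigma_subadditive _ _ _ mu (\bigcup_N B N) B mB _ _)) => //.
    exact: bigcupT_measurable.
  by rewrite eseries0// => N _ _; exact: B0.
have muV : mu (~` V) = 0%E.
  apply: (subset_measure0 _ _ nV muB); [exact: measurableC|exact: bigcupT_measurable].
have mVc : measurable (V `&` cube) by exact: measurableI.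
have mVCc : measurable (~` V `&` cube) by apply: measurableI => //; exact: measurableC.
rewrite torus_LebE -/V; apply/eqP; rewrite eq_le -(@lebesgue_unit_cube R (n * m)).
apply/andP; split; first by apply: le_measure; rewrite ?inE//; exact: subIsetr.
apply: (@le_trans _ _ (leb (n * m) ((V `&` cube) `|` (~` V `&` cube)))).
  by rewrite -setIUl setUCr setTI.
apply: (le_trans (measureU2 _ mVc mVCc)).
rewrite -[leRHS]adde0; apply: leeD => //.
by rewrite -muV.
Qed.

End Torus.

Theorem theorem2p2 (R : realType) (m n : nat) (hm : (0 < m)%N) (hn : (0 < n)%N)
    (P : 'rV[int]_n -> set 'rV[int]_m) (hP : forall q, P q = setT)
    (psi : 'rV[nat]_n -> R) (psi_ge0 : forall q, 0 <= psi q) :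
  ((\esum_(q in setT) (psi q ^+ m)%:E < +oo)%E ->
    torus_Leb (W P psi) = 0%E) /\
  ((\esum_(q in setT) (psi q ^+ m)%:E = +oo)%E ->
    (forall d e : nat, (0 < d)%N -> (d <= e)%N ->
      (Psi m psi e <= Psi m psi d)%E) ->
    torus_Leb (W P psi) = 1%E).
Proof. by split; [exact: torus_Leb_W0|exact: torus_Leb_W1]. Qed.
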